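(* Let $C\subset[0,1]$ be the Cantor ternary set, let $h:[0,1]\to[0,1]$ be the classical Cantor function (Devil's Staircase), and let $K=\{(x,h(x)):x\in C\}\subset\mathbb{R}^2$ be the graph of $h$ restricted to $C$. Then $K$ is a closed set which is not intervally thin, and for every open set $U\subset\mathbb{R}^2$ containing $K$, every locally convex function $f:U\setminus K\to\mathbb{R}$ has a unique locally convex extension to $U$.
   Context: $B(x,\varepsilon)$ is the open Euclidean ball with centre $x$ and radius $\varepsilon$; $[x,y]$ is the line segment with endpoints $x,y$. A set $A\subset\mathbb{R}^d$ is intervally thin if for any $x,y\in\mathbb{R}^d$ and any $\varepsilon>0$ there exist $x'\in B(x,\varepsilon)$ and $y'\in B(y,\varepsilon)$ such that $[x',y']\cap A=\emptyset$. For $U\subset\mathbb{R}^d$ open, a function $f:U\to\mathbb{R}$ is locally convex on $U$ if every point of $U$ has an open convex neighbourhood $V\subset U$ such that $f|_V$ is convex. *)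

(* Defs.v *)
From mathcomp Require Import all_boot all_order all_algebra.
From mathcomp Require Import all_classical all_reals all_analysis.

Set Implicit Arguments.
Unset Strict Implicit.
Unset Printing Implicit Defensive.

Import Order.TTheory GRing.Theory Num.Theory.
Import numFieldNormedType.Exports.

Local Open Scope classical_set_scope.
Local Open Scope ring_scope.

(* The library norm on 'rV[R]_d is the sup norm, hence a separate Euclidean
   norm; the two induce the same topology, so [open] and [closed] below are
   the library's. *)
Definition enorm (R : realType) (d : nat) (v : 'rV[R]_d) : R :=
  Num.sqrt (\sum_(i < d) v ord0 i ^+ 2).

Definition eball (R : realType) (d : nat) (x : 'rV[R]_d) (e : R) :
    set 'rV[R]_d :=
  [set y | enorm (y - x) < e].

Definition segment (R : realType) (d : nat) (x y : 'rV[R]_d) :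
    set 'rV[R]_d :=
  [set (1 - t) *: x + t *: y | t in `[0, 1]].

Definition intervally_thin (R : realType) (d : nat) (A : set 'rV[R]_d) : Prop :=
  forall (x y : 'rV[R]_d) (e : R), 0 < e ->
  exists x' y' : 'rV[R]_d,
    [/\ eball x e x', eball y e y' & segment x' y' `&` A = set0].

(* A function U -> R is represented by a total function, of which only the
   values on U matter: V is contained in U and [convex_function V f] only
   constrains f on the convex set V. *)
Definition locally_convex_on (R : realType) (d : nat) (U : set 'rV[R]_d)
    (f : 'rV[R]_d -> R) : Prop :=
  forall x : 'rV[R]_d, U x ->
  exists V : set 'rV[R]_d,
    [/\ open V, @convex_set R 'rV[R]_d V, V x, V `<=` U
      & @convex_function R 'rV[R]_d V f].

Definition locally_convex_extension (R : realType) (d : nat)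
    (U K : set 'rV[R]_d) (f g : 'rV[R]_d -> R) : Prop :=
  locally_convex_on U g /\ (forall x, (U `\` K) x -> g x = f x).

Fixpoint cantor_stage (R : realType) (n : nat) : set R :=
  if n is m.+1 then
    [set x / 3 | x in cantor_stage m] `|`
    [set (x + 2) / 3 | x in cantor_stage m]
  else `[0, 1].

Arguments cantor_stage R n : clear implicits.

Definition cantor_ternary_set (R : realType) : set R :=
  \bigcap_n cantor_stage R n.

Arguments cantor_ternary_set R : clear implicits.

Fixpoint cantor_function_approx (R : realType) (n : nat) (x : R) : R :=
  if n is m.+1 then
    if x <= 1 / 3 then cantor_function_approx m (3 * x) / 2
    else if x <= 2 / 3 then 1 / 2
    else 1 / 2 + cantor_function_approx m (3 * x - 2) / 2
  else x.

(* The approximations converge uniformly on [0, 1]; the values of the limit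
   outside [0, 1] are irrelevant. *)
Definition cantor_function (R : realType) (x : R) : R :=
  limn (fun n => cantor_function_approx n x).

Definition plane_point (R : realType) (x y : R) : 'rV[R]_2 :=
  \row_(i < 2) (if i == ord0 then x else y).

Definition cantor_graph (R : realType) : set 'rV[R]_2 :=
  [set plane_point x (cantor_function x) | x in cantor_ternary_set R].

Arguments cantor_graph R : clear implicits.

(* Main.v *)
Require Import Defs.
From mathcomp Require Import all_boot all_order all_algebra.
From mathcomp Require Import all_classical all_reals all_analysis.
From mathcomp Require Import ring lra.
Import Order.TTheory GRing.Theory Num.Theory.
Import numFieldNormedType.Exports.
Local Open Scope classical_set_scope.
Local Open Scope ring_scope.

Set Implicit Arguments.
Unset Strict Implicit.
Unset Printing Implicit Defensive.

(** Write [h] for the Cantor function and [K] for its graph over the Cantor set.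

    [K] is not intervally thin because a line of positive slope that starts
    above the graph of [h] and ends below it must cross it downwards, and this
    cannot happen on a plateau of [h] ([increasing_line_meets]).

    Lines of negative slope behave differently: since [h + k id] is injective
    for [k > 0], they avoid [K] after an arbitrarily small translation
    ([decreasing_line_avoids]). So let [G] be the extension of [f] whose values
    on [K] are upper limits of [f]. It is upper semicontinuous, and convex on
    segments of negative slope, hence, in the limit, on horizontal and vertical
    ones ([usc_extension_decreasing]).

    For a segment of positive slope, suppose that convexity fails. A maximum
    principle ([nonconvex_touching]) yields a point [q] at which [G] is touched
    from above by a quadratic polynomial that is strictly concave in the
    direction of the segment; subtract its affine part. Convexity on horizontal
    and vertical lines then bounds [G] from below at distance [s] along the
    increasing ray from [q] by a multiple of [- s ^ 2]. Now [K] is steep: at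
    every scale either a gap of the Cantor set or the growth of [h] leaves the
    points of the ray at distances between [t] and [L t] off [K], for [L] as
    large as desired and suitable arbitrarily small [t] ([free_ray]). On this
    stretch [G] is [f], which is convex there, and convexity forces values that
    are too low near [t] ([touching_contradiction]).

    Uniqueness holds because locally convex functions are continuous and [K]
    has empty interior. *)

(** * The ternary Cantor set *)

Lemma pow3_gt0 (R : realType) n : 0 < (3^-1 : R) ^+ n.
Proof. by apply: exprn_gt0; lra. Qed.

Lemma cantor_stageS_sub (R : realType) n :
  cantor_stage R n.+1 `<=` cantor_stage R n.
Proof.
elim: n => [|n IHn] x.
  by case=> -[z /=]; rewrite !in_itv /= => /andP[z0 z1] <-; apply/andP; lra.
by case=> -[z /IHn ? <-]; [left|right]; exists z.
Qed.

Lemma cantor_stage01 (R : realType) n x :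
  cantor_stage R n x -> 0 <= x <= 1.
Proof.
elim: n x => [|n IHn] x; first by rewrite /= in_itv.
by move=> /cantor_stageS_sub /IHn.
Qed.

Lemma cantor01 {R : realType} {x : R} : cantor_ternary_set R x -> 0 <= x <= 1.
Proof. by move=> /(_ 0%N I); apply: cantor_stage01. Qed.

Lemma cantor_third (R : realType) (x : R) : cantor_ternary_set R x ->
  (x <= 1 / 3 /\ cantor_ternary_set R (3 * x)) \/
  (2 / 3 <= x /\ cantor_ternary_set R (3 * x - 2)).
Proof.
move=> Cx; have [xle|xgt] := leP x (1 / 3).
  left; split=> // n _; case: (Cx n.+1 I) => -[z Sz zx].
    by have -> : 3 * x = z by lra.
  by have /andP[? ?] := cantor_stage01 Sz; lra.
right; split.
  case: (Cx 1%N I) => -[z]; rewrite /= in_itv /= => /andP[? ?] zx; lra.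
move=> n _; case: (Cx n.+1 I) => -[z Sz zx].
  by have /andP[? ?] := cantor_stage01 Sz; lra.
by have -> : 3 * x - 2 = z by lra.
Qed.

Lemma cantor_stage_endpoints (R : realType) n :
  cantor_stage R n 0 /\ cantor_stage R n 1.
Proof.
elim: n => [|n [IH0 IH1]]; first by rewrite /= !in_itv /=; split; lra.
by split; [left; exists 0|right; exists 1] => //; lra.
Qed.

Lemma cantor_stage_open (R : realType) n (x : R) : ~ cantor_stage R n x ->
  exists2 r, 0 < r & forall y, `|y - x| < r -> ~ cantor_stage R n y.
Proof.
elim: n x => [|n IHn] x /=.
  rewrite in_itv /= => /negP; rewrite negb_and -!ltNge => /orP[x0|x1].
    exists (- x); first lra.
    by move=> y; rewrite ltr_norml in_itv /= => /andP[? ?] /andP[? ?]; lra.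
  exists (x - 1); first lra.
  by move=> y; rewrite ltr_norml in_itv /= => /andP[? ?] /andP[? ?]; lra.
move=> Sx.
have [r r0 Hr] : exists2 r, 0 < r &
    forall y, `|y - 3 * x| < r -> ~ cantor_stage R n y.
  by apply: IHn => S; apply: Sx; left; exists (3 * x) => //; lra.
have [s s0 Hs] : exists2 r, 0 < r &
    forall y, `|y - (3 * x - 2)| < r -> ~ cantor_stage R n y.
  by apply: IHn => S; apply: Sx; right; exists (3 * x - 2) => //; lra.
exists (Num.min r s / 3); first by rewrite divr_gt0 // lt_min r0.
move=> y; rewrite ltr_pdivlMr // lt_min => /andP[yr ys].
have dist u : `|u| * 3 = `|3 * u| by rewrite normrM ger0_norm // mulrC.
rewrite dist in yr ys.
case=> -[z Sz zy].
  by apply: (Hr z) => //; have -> : z - 3 * x = 3 * (y - x) by lra.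
by apply: (Hs z) => //; have -> : z - (3 * x - 2) = 3 * (y - x) by lra.
Qed.

Lemma cantor_open (R : realType) (x : R) : ~ cantor_ternary_set R x ->
  exists2 r, 0 < r & forall y, `|y - x| < r -> ~ cantor_ternary_set R y.
Proof.
move=> /existsNP [n /not_implyP [_ /cantor_stage_open [r r0 Hr]]].
by exists r => // y /Hr Sy Cy; apply/Sy/Cy.
Qed.

(** * The Cantor function *)

Lemma approx01 (R : realType) n (x : R) : 0 <= x <= 1 ->
  0 <= cantor_function_approx n x <= 1.
Proof.
elim: n x => [//|n IHn] x x01 /=; case: ifPn => [x1|].
  have /IHn : 0 <= 3 * x <= 1 by lra.
  lra.
rewrite -ltNge => x1; case: ifPn => [x2|]; first lra.
rewrite -ltNge => x2; have /IHn : 0 <= 3 * x - 2 <= 1 by lra.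
lra.
Qed.

(** Iterating the recursion halves the distance of the values at each step. *)
Lemma approx_dist (R : realType) n m (x : R) : 0 <= x <= 1 ->
  `|cantor_function_approx (n + m) x - cantor_function_approx n x|
    <= 2^-1 ^+ n.
Proof.
elim: n x => [|n IHn] x x01.
  rewrite add0n expr0 ler_norml /=.
  by have /andP[] := approx01 m x01; lra.
rewrite addSn exprS /=; case: ifPn => [x1|].
  have /IHn : 0 <= 3 * x <= 1 by lra.
  by rewrite !ler_norml; lra.
rewrite -ltNge => x1; case: ifPn => [x2|].
  by rewrite subrr normr0 mulr_ge0 ?exprn_ge0 //; lra.
rewrite -ltNge => x2.
have /IHn : 0 <= 3 * x - 2 <= 1 by lra.
by rewrite !ler_norml; lra.
Qed.

Lemma geometric_small (R : realType) (q e : R) : 0 <= q < 1 -> 0 < e ->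
  exists n, q ^+ n < e.
Proof.
move=> /andP[q0 q1] e0.
have /cvgrPdist_lt/(_ _ e0) [n _ /(_ n (leqnn n)) H] :=
  @cvg_expr R q ltac:(rewrite ger0_norm; lra).
by exists n; move: H; rewrite /= sub0r normrN ger0_norm ?exprn_ge0.
Qed.

Lemma approx_cvg (R : realType) (x : R) : 0 <= x <= 1 ->
  cvgn (fun n => cantor_function_approx n x).
Proof.
move=> x01; apply/cauchy_cvgP/cauchy_exP => e e0.
have [n ne] : exists n, (2^-1 : R) ^+ n < e.
  by apply: geometric_small => //; lra.
exists (cantor_function_approx n x); exists n => // m /= nm.
rewrite -ball_normE /= distrC.
by apply: le_lt_trans ne; rewrite -(subnKC nm); exact: approx_dist.
Qed.

Lemma cantor_function_cvg (R : realType) (x : R) : 0 <= x <= 1 ->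
  (fun n => cantor_function_approx n x) @ \oo --> cantor_function x.
Proof. by move=> /approx_cvg. Qed.

Lemma cantor_function01 (R : realType) (x : R) : 0 <= x <= 1 ->
  0 <= cantor_function x <= 1.
Proof.
move=> x01; apply/andP; split.
  apply: limr_ge; first exact: approx_cvg.
  by apply: nearW => n; have /andP[] := approx01 n x01.
apply: limr_le; first exact: approx_cvg.
by apply: nearW => n; have /andP[] := approx01 n x01.
Qed.

Lemma cantor_function_left (R : realType) (x : R) : 0 <= x <= 1 / 3 ->
  cantor_function x = cantor_function (3 * x) / 2.
Proof.
move=> x01; apply/cvg_lim => //; rewrite -cvg_shiftS.
rewrite (_ : (fun _ => _) = fun n => cantor_function_approx n (3 * x) / 2).
  by apply: cvgMl; apply: cantor_function_cvg; lra.
apply/funext => n /=; rewrite ifT //; lra.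
Qed.

Lemma cantor_function_right (R : realType) (x : R) : 2 / 3 <= x <= 1 ->
  cantor_function x = 1 / 2 + cantor_function (3 * x - 2) / 2.
Proof.
move=> x01; apply/cvg_lim => //; rewrite -cvg_shiftS.
rewrite (_ : (fun _ => _) =
    fun n => 1 / 2 + cantor_function_approx n (3 * x - 2) / 2).
  by apply: cvgD; [exact: cvg_cst|apply: cvgMl; apply: cantor_function_cvg; lra].
apply/funext => n /=; rewrite ifF; last by apply/negbTE; rewrite -ltNge; lra.
case: ifPn => // x2.
have -> : 3 * x - 2 = 0 :> R by lra.
suff -> : cantor_function_approx n (0 : R) = 0 by rewrite mul0r addr0.
by elim: n => //= n IHn; rewrite ifT ?mulr0 ?IHn ?mul0r//; lra.
Qed.

Lemma cantor_function_middle (R : realType) (x : R) : 1 / 3 <= x <= 2 / 3 ->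
  cantor_function x = 1 / 2.
Proof.
move=> x12; have [x1|x1] := ltP (1 / 3) x; last first.
  have {x1 x12} -> : x = 1 / 3 by lra.
  rewrite cantor_function_left; last lra.
  rewrite (_ : 3 * (1 / 3) = 1 :> R); last by lra.
  suff -> : cantor_function (1 : R) = 1 by [].
  apply/cvg_lim => //; rewrite (_ : (fun _ => _) = cst 1); first exact: cvg_cst.
  apply/funext; elim=> //= n IHn; rewrite ifF; last by apply/negbTE; rewrite -ltNge; lra.
  rewrite ifF; last by apply/negbTE; rewrite -ltNge; lra.
  rewrite (_ : 3 * 1 - 2 = 1); last by lra.
  by rewrite IHn /=; lra.
apply/cvg_lim => //; rewrite -cvg_shiftS.
rewrite (_ : (fun _ => _) = cst (1 / 2)); first exact: cvg_cst.
apply/funext => n /=; rewrite ifF; last by apply/negbTE; rewrite -ltNge; lra.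
by rewrite ifT //; lra.
Qed.

Lemma approx_nondecreasing (R : realType) n (x y : R) : 0 <= x -> x <= y ->
  y <= 1 -> cantor_function_approx n x <= cantor_function_approx n y.
Proof.
elim: n x y => [//|n IHn] x y x0 xy y1 /=.
have bounds z : 0 <= z <= 1 -> _ := @approx01 R n z.
case: ifPn => [x13|].
  have [] := (bounds (3 * x), IHn (3 * x) (3 * y)).
  case: ifPn => [y13|]; first lra.
  rewrite -ltNge => y13; case: ifPn => [y23|]; first lra.
  rewrite -ltNge => y23; have := bounds (3 * y - 2); lra.
rewrite -ltNge => x13; rewrite (_ : (y <= 1 / 3) = false); last by apply/negbTE; rewrite -ltNge; lra.
have := IHn (3 * x - 2) (3 * y - 2).
have := bounds (3 * y - 2).
case: ifPn => [x23|]; case: ifPn => [y23|]; rewrite -?ltNge; lra.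
Qed.

Lemma cantor_function_nondecreasing {R : realType} (x y : R) : 0 <= x ->
  x <= y -> y <= 1 -> cantor_function x <= cantor_function y.
Proof.
move=> x0 xy y1; apply: ler_lim; [apply: approx_cvg; lra..|].
by apply: nearW => n; exact: approx_nondecreasing.
Qed.

Lemma cantor_function_0 (R : realType) : cantor_function (0 : R) = 0.
Proof. by have := @cantor_function_left R 0; rewrite mulr0; lra. Qed.

Lemma cantor_function_1 (R : realType) : cantor_function (1 : R) = 1.
Proof.
have := @cantor_function_right R 1; rewrite (_ : 3 * 1 - 2 = 1); last lra.
lra.
Qed.

(** The self-similarity of the graph turns one step of the induction into the
    same estimate one scale up, because two points closer than [1 / 3] that lie
    in different thirds are separated by a plateau of height [1 / 2]. *)
Lemma cantor_function_modulus {R : realType} n (x y : R) : 0 <= x -> x <= y ->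
  y <= 1 -> y - x <= 3^-1 ^+ n ->
  cantor_function y - cantor_function x <= 2^-1 ^+ n.
Proof.
elim: n x y => [|n IHn] x y x0 xy y1.
  have := @cantor_function01 R x; have := @cantor_function01 R y.
  by rewrite !expr0; lra.
rewrite !exprS => dxy.
have p0 : 0 <= (2^-1 : R) ^+ n by rewrite exprn_ge0 //; lra.
have p1 : (3^-1 : R) ^+ n <= 1 by apply: exprn_ile1; lra.
have left_third (u v : R) : 0 <= u -> u <= v -> v <= 1 / 3 ->
    v - u <= 3^-1 * 3^-1 ^+ n ->
    cantor_function v - cantor_function u <= 2^-1 * 2^-1 ^+ n.
  move=> u0 uv v1 duv; have := IHn (3 * u) (3 * v).
  by rewrite (@cantor_function_left R u) ?(@cantor_function_left R v); lra.
have right_third (u v : R) : 2 / 3 <= u -> u <= v -> v <= 1 ->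
    v - u <= 3^-1 * 3^-1 ^+ n ->
    cantor_function v - cantor_function u <= 2^-1 * 2^-1 ^+ n.
  move=> u0 uv v1 duv; have := IHn (3 * u - 2) (3 * v - 2).
  by rewrite (@cantor_function_right R u) ?(@cantor_function_right R v); lra.
have mid := @cantor_function_middle R.
have [x1|x1] := leP x (1 / 3).
  have [y1'|y1'] := leP y (1 / 3); first by apply: left_third; lra.
  have := left_third x (1 / 3); have := mid (1 / 3); have := mid y; lra.
have [y2|y2] := leP y (2 / 3).
  by have := mid x; have := mid y; lra.
have [x2|x2] := leP (2 / 3) x; first by apply: right_third; lra.
have := right_third (2 / 3) y; have := mid (2 / 3); have := mid x; lra.
Qed.

Lemma cantor_function_continuous (R : realType) (x e : R) : 0 <= x <= 1 ->
  0 < e -> exists2 r, 0 < r & forall y, 0 <= y <= 1 -> `|y - x| < r ->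
    `|cantor_function y - cantor_function x| < e.
Proof.
move=> x01 e0; have [n ne] : exists n, (2^-1 : R) ^+ n < e.
  by apply: geometric_small => //; lra.
exists (3^-1 ^+ n); first exact: pow3_gt0.
move=> y y01; rewrite !ltr_norml => /andP[d1 d2].
have [xy|/ltW yx] := leP x y.
  have := @cantor_function_nondecreasing R x y.
  by have := @cantor_function_modulus R n x y; lra.
have := @cantor_function_nondecreasing R y x.
by have := @cantor_function_modulus R n y x; lra.
Qed.

(** The triadic interval of rank [n] around a point of the Cantor set: the
    Cantor function grows by [2^-n] on an interval of length [3^-n], whose
    midpoint lies in a gap. *)
Lemma cantor_cylinder {R : realType} n (x : R) : cantor_ternary_set R x ->
  exists a, [/\ 0 <= a, a <= x <= a + 3^-1 ^+ n, a + 3^-1 ^+ n <= 1,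
    cantor_function (a + 3^-1 ^+ n) = cantor_function a + 2^-1 ^+ n
    & ~ cantor_ternary_set R (a + 3^-1 ^+ n / 2)].
Proof.
elim: n x => [|n IHn] x Cx.
  have x01 := cantor01 Cx; exists 0; rewrite !expr0 add0r.
  split; [by []|by []|by []|by rewrite cantor_function_0 cantor_function_1 add0r|].
  by move=> /cantor_third; lra.
have p0 := pow3_gt0 R n; rewrite !exprS.
have [[x1 /IHn]|[x2 /IHn]] := cantor_third Cx.
  move=> [a [a0 ax a1 ha nC]]; exists (a / 3); split; try lra.
    have := @cantor_function_left R (a / 3).
    have := @cantor_function_left R (a / 3 + 3^-1 * 3^-1 ^+ n).
    rewrite (_ : 3 * (a / 3) = a); last lra.
    rewrite (_ : 3 * (_ + _) = a + 3^-1 ^+ n); last lra.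
    lra.
  move=> /cantor_third [[_]|]; last lra.
  by rewrite (_ : 3 * _ = a + 3^-1 ^+ n / 2); last lra.
move=> [a [a0 ax a1 ha nC]]; exists ((a + 2) / 3); split; try lra.
  have := @cantor_function_right R ((a + 2) / 3).
  have := @cantor_function_right R ((a + 2) / 3 + 3^-1 * 3^-1 ^+ n).
  rewrite (_ : 3 * ((a + 2) / 3) - 2 = a); last lra.
  rewrite (_ : 3 * (_ + _) - 2 = a + 3^-1 ^+ n); last lra.
  lra.
move=> /cantor_third [|[_]]; first lra.
by rewrite (_ : 3 * _ - 2 = a + 3^-1 ^+ n / 2); last lra.
Qed.

Lemma cantor_empty_interior (R : realType) (x r : R) : cantor_ternary_set R x ->
  0 < r -> exists y, [/\ 0 <= y <= 1, `|y - x| < r & ~ cantor_ternary_set R y].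
Proof.
move=> Cx r0; have [n nr] : exists n, (3^-1 : R) ^+ n < r.
  by apply: geometric_small => //; lra.
have p0 := pow3_gt0 R n.
have [a [a0 /andP[ax1 ax2] a1 _ nC]] := cantor_cylinder n Cx.
exists (a + 3^-1 ^+ n / 2); split => //; first lra.
rewrite ltr_norml; lra.
Qed.

Lemma cantor_function_locally_constant (R : realType) (x : R) : 0 <= x <= 1 ->
  ~ cantor_ternary_set R x ->
  exists2 r, 0 < r & forall y, 0 <= y <= 1 -> `|y - x| < r ->
    cantor_function y = cantor_function x.
Proof.
move=> x01 /existsNP [n /not_implyP [_]].
elim: n x x01 => [|n IHn] x x01; first by rewrite /= in_itv.
move=> nS; have end1 := cantor_stage_endpoints R n.
have [x1|x1] := ltP x (1 / 3).
  have [||r r0 Hr] := IHn (3 * x); first lra.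
    by move=> S; apply: nS; left; exists (3 * x) => //; lra.
  exists (Num.min (r / 3) (1 / 3 - x)); first by rewrite lt_min; apply/andP; lra.
  move=> y y01; rewrite lt_min !ltr_norml => /andP[d1 d2].
  rewrite (@cantor_function_left R x) ?(@cantor_function_left R y); try lra.
  rewrite (Hr (3 * y)) //; first lra.
  by rewrite ltr_norml; lra.
have [x2|x2] := ltP (2 / 3) x.
  have [||r r0 Hr] := IHn (3 * x - 2); first lra.
    by move=> S; apply: nS; right; exists (3 * x - 2) => //; lra.
  exists (Num.min (r / 3) (x - 2 / 3)); first by rewrite lt_min; apply/andP; lra.
  move=> y y01; rewrite lt_min !ltr_norml => /andP[d1 d2].
  rewrite (@cantor_function_right R x) ?(@cantor_function_right R y); try lra.
  rewrite (Hr (3 * y - 2)) //; first lra.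
  by rewrite ltr_norml; lra.
have [x1'|x1'] := eqVneq x (1 / 3).
  by case: nS; left; exists 1; [case: end1|lra].
have [x2'|x2'] := eqVneq x (2 / 3).
  by case: nS; right; exists 0; [case: end1|lra].
(* the open middle third, where the function is constant *)
exists (Num.min (x - 1 / 3) (2 / 3 - x)).
  by rewrite lt_min !subr_gt0 !lt_neqAle x2' x2 eq_sym x1' x1.
move=> y y01; rewrite lt_min !ltr_norml => /andP[d1 d2].
by rewrite !cantor_function_middle; lra.
Qed.

(** * The graph of the Cantor function over the Cantor set *)

(** The set [cantor_graph] in coordinates, see [planar_cantor_graph]. *)
Definition graph_point (R : realType) (x y : R) :=
  cantor_ternary_set R x /\ y = cantor_function x.

Lemma graph_open (R : realType) (x y : R) : ~ graph_point x y ->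
  exists2 r, 0 < r & forall x' y', `|x' - x| < r -> `|y' - y| < r ->
    ~ graph_point x' y'.
Proof.
move=> nG; have [Cx|/cantor_open [r r0 Hr]] := pselect (cantor_ternary_set R x).
  have e0 : 0 < `|y - cantor_function x| / 2.
    rewrite divr_gt0 // normr_gt0 subr_eq0.
    by apply/negP => /eqP yh; apply: nG.
  have [r r0 Hr] := cantor_function_continuous (cantor01 Cx) e0.
  exists (Num.min r (`|y - cantor_function x| / 2)); first by rewrite lt_min r0.
  move=> x' y'; rewrite !lt_min => /andP[dx _] /andP[_ dy] [Cx' y'E].
  have := Hr _ (cantor01 Cx') dx; rewrite -y'E.
  have := ler_distD y' y (cantor_function x).
  by rewrite (distrC y y'); lra.
by exists r => // x' y' /Hr nC _ [].
Qed.

(** The line of slope [- b / a] meets the graph over the zeros, in the Cantor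
    set, of [h + b / a * id - c]. This function is strictly increasing, so a
    value that it takes at a point outside the Cantor set is not taken on the
    Cantor set; such points exist arbitrarily close to any point. *)
Lemma decreasing_line_avoids (R : realType) (a b x y e : R) :
  0 < a -> 0 < b -> 0 < e ->
  exists dx dy, [/\ `|dx| < e, `|dy| < e &
    forall s, ~ graph_point (x + dx + s * a) (y + dy - s * b)].
Proof.
move=> a0 b0 e0.
have [[s0 [Cs0 ys0]]|nG] :=
  pselect (exists s, graph_point (x + s * a) (y - s * b)); last first.
  exists 0, 0; rewrite !normr0 !addr0; split=> // s Gs; apply: nG.
  by exists s; move: Gs.
have [r r0 Hr] := cantor_function_continuous (cantor01 Cs0) e0.
have [] := @cantor_empty_interior R _ (Num.min r e) Cs0.
  by rewrite lt_min r0.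
move=> m [m01 + nCm]; rewrite lt_min => /andP[/(Hr _ m01) dm de].
(* move the intersection point of the line and the graph to the point of the
   full Cantor graph over m, which is not in the Cantor set *)
exists (m - (x + s0 * a)), (cantor_function m - cantor_function (x + s0 * a)).
split=> // s; set x' := (x in graph_point x _).
have x'E : x' = m + (s - s0) * a by rewrite /x'; ring.
move=> [Cx' yE]; have x'01 := cantor01 Cx'.
have {}yE : cantor_function x' = cantor_function m - (s - s0) * b.
  by rewrite -yE -ys0; ring.
have [ss|ss|ss] := ltgtP s s0.
- have : (s - s0) * a < 0 by rewrite nmulr_rlt0 // subr_lt0.
  have : (s - s0) * b < 0 by rewrite nmulr_rlt0 // subr_lt0.
  by have := @cantor_function_nondecreasing R x' m; lra.
- have : 0 < (s - s0) * a by rewrite mulr_gt0 // subr_gt0.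
  have : 0 < (s - s0) * b by rewrite mulr_gt0 // subr_gt0.
  by have := @cantor_function_nondecreasing R m x'; lra.
by apply: nCm; rewrite -(_ : x' = m) // x'E ss; ring.
Qed.

(** The graph is nondecreasing, the antidiagonal line is decreasing. *)
Lemma decreasing_line_meets_once (R : realType) (x y s : R) :
  graph_point x y -> s != 0 -> ~ graph_point (x + s) (y - s).
Proof.
move=> [Cx yE] s0 [Cxs yEs].
have x01 := cantor01 Cx; have xs01 := cantor01 Cxs.
have /orP[sl|sg] : (s < 0) || (0 < s) by rewrite -neq_lt.
- by have := @cantor_function_nondecreasing R (x + s) x; lra.
- by have := @cantor_function_nondecreasing R x (x + s); lra.
Qed.

(** The line lies above the graph at [0] and below it at [1]. At the last point
    where it is above or on the graph it has to cross downwards, which an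
    increasing line cannot do on a plateau; so the crossing is over the Cantor
    set. *)
Lemma increasing_line_meets (R : realType) (c k : R) :
  0 < k -> 0 <= c -> c + k < 1 -> exists x, graph_point x (c + k * x).
Proof.
move=> k0 c0 ck1.
pose S := [set t : R | 0 <= t <= 1 /\ cantor_function t <= c + k * t].
have S0 : S 0 by split; [lra|rewrite cantor_function_0 mulr0 addr0].
have supS : has_sup S by split; [exists 0|exists 1 => t [/andP[]]].
have t0ub t : S t -> t <= sup S by move=> St; apply: ub_le_sup => //; case: supS.
set t0 := sup S in t0ub.
have t0_ge0 := t0ub _ S0.
have t0_le1 : t0 <= 1 by apply: ge_sup; [exists 0|move=> t [/andP[]]].
have t001 : 0 <= t0 <= 1 by rewrite t0_ge0.
have below : cantor_function t0 <= c + k * t0.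
  rewrite leNgt; apply/negP => above.
  have [r r0 Hr] := cantor_function_continuous t001
    (e := cantor_function t0 - (c + k * t0)) ltac:(by rewrite subr_gt0).
  have [t St tt0] := sup_adherent r0 supS.
  rewrite -/t0 in tt0; have tle := t0ub _ St; case: St => t01 ht.
  have := Hr _ t01; rewrite !ltr_norml.
  have : k * t <= k * t0 by rewrite ler_pM2l.
  lra.
have t0_lt1 : t0 < 1.
  rewrite lt_neqAle t0_le1 andbT; apply/eqP => t01.
  by move: below; rewrite t01 cantor_function_1; lra.
(* just after t0 the graph lies above the line *)
have after r : 0 < r -> exists t, [/\ 0 <= t <= 1, t0 < t < t0 + r
    & c + k * t0 < cantor_function t - k * (t - t0)].
  move=> r0; pose d := Num.min r (1 - t0) / 2.
  have d0 : 0 < d by rewrite divr_gt0 // lt_min r0 subr_gt0.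
  have dr : d < r by apply: (@lt_le_trans _ _ (Num.min r (1 - t0)));
    [rewrite /d in d0 *; lra|rewrite ge_min lexx].
  have d1 : d < 1 - t0 by apply: (@lt_le_trans _ _ (Num.min r (1 - t0)));
    [rewrite /d in d0 *; lra|rewrite ge_min lexx orbT].
  exists (t0 + d); split; [lra|lra|].
  rewrite ltNge; apply/negP => le; suff /t0ub : S (t0 + d) by lra.
  by split; [lra|move: le; rewrite (_ : t0 + d - t0 = d); lra].
have [Ct0|nCt0] := pselect (cantor_ternary_set R t0).
  exists t0; split=> //; apply/eqP; rewrite eq_le below andbT leNgt.
  apply/negP => above.
  have [r r0 Hr] := cantor_function_continuous t001
    (e := c + k * t0 - cantor_function t0) ltac:(by rewrite subr_gt0).
  have [t [t01 tt0 ht]] := after r r0.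
  have : 0 < k * (t - t0) by rewrite mulr_gt0 // subr_gt0; lra.
  by have := Hr t t01; rewrite !ltr_norml; lra.
have [r r0 Hr] := cantor_function_locally_constant t001 nCt0.
have [t [t01 tt0 ht]] := after r r0.
have : 0 < k * (t - t0) by rewrite mulr_gt0 // subr_gt0; lra.
by move: ht; rewrite Hr // ?ltr_norml; lra.
Qed.

(** The graph is steep at small scales: at distance about [3^-n] on the right
    of a point of the graph, either there is a gap of the Cantor set of large
    relative length, or the function has already increased by [2^-n], which
    brings the graph above any line of given slope for a long time. *)
Lemma free_ray_from_graph (R : realType) (x k L d : R) :
  cantor_ternary_set R x -> 0 <= k -> 1 <= L -> 0 < d ->
  exists t, [/\ 0 < t, L * t < d & forall s, t <= s <= L * t ->
    ~ graph_point (x + s) (cantor_function x + k * s)].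
Proof.
move=> Cx k0 L1 d0.
(* D is chosen so that (2 / 3) ^ n * D < min d 1 puts both stretches below
   distance d and keeps the rise of the line below 2^-n *)
pose D := 2 * L ^+ 2 * (1 + k).
have D0 : 0 < D by rewrite !mulr_gt0 ?exprn_gt0 //; lra.
have [n] : exists n, (2 / 3 : R) ^+ n < Num.min d 1 / D.
  by apply: geometric_small; [lra|rewrite divr_gt0 // lt_min d0 /=].
rewrite ltr_pdivlMr // lt_min => /andP[qd q1].
have p0 := pow3_gt0 R n.
have w0 : 0 < (2^-1 : R) ^+ n by rewrite exprn_gt0 //; lra.
have w1 : (2^-1 : R) ^+ n <= 1 by apply: exprn_ile1; lra.
have pqw : (3^-1 : R) ^+ n = (2 / 3) ^+ n * 2^-1 ^+ n.
  by rewrite -exprMn; congr (_ ^+ n); lra.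
set p := 3^-1 ^+ n in p0 pqw; set w := 2^-1 ^+ n in w0 w1 pqw.
set q := (2 / 3) ^+ n in qd q1 pqw.
have q0 : 0 <= q by apply: exprn_ge0; lra.
have LL : L <= L ^+ 2 by rewrite expr2; nra.
have kL : 0 <= k * L ^+ 2 by rewrite mulr_ge0 // exprn_ge0; lra.
have DE : D = 2 * L ^+ 2 + 2 * (k * L ^+ 2) by rewrite /D; ring.
have pq : p <= q by rewrite pqw ler_piMr.
have pD : p * D <= q * D by rewrite ler_pM2r.
have pDw : p * D < w by rewrite pqw mulrAC gtr_pMl.
have pDE : p * D = 2 * (p * L ^+ 2) + 2 * (p * (k * L ^+ 2)) by rewrite DE; ring.
have pL : p * L <= p * L ^+ 2 by rewrite ler_pM2l.
have pkL : 0 <= p * (k * L ^+ 2) by rewrite mulr_ge0 // ltW.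
have pLp : p <= p * L by rewrite ler_peMr // ltW.
have [free|] := pselect (forall s, p <= s <= L * p ->
    ~ cantor_ternary_set R (x + s)).
  exists p; split=> //; first by rewrite mulrC; lra.
  by move=> s /free nC [].
move=> /existsNP [s /not_implyP [/andP[s1 s2] /contrapT Cs]].
(* the triadic interval of length p around x + s lies between x and x + 2 * L * p,
   so that beyond it the graph is at least w above its starting height *)
exists (2 * L * p); split; first by rewrite !mulr_gt0 //; lra.
  have -> : L * (2 * L * p) = 2 * (p * L ^+ 2) by ring.
  lra.
move=> s' /andP[s'1 s'2] [Cs' hs'].
have [a [a0 /andP[a1 a2] a3 ha _]] := cantor_cylinder n Cs.
rewrite -/p -/w in a2 a3 ha.
have x01 := cantor01 Cx; have xs01 := cantor01 Cs'.
have s'1' : 2 * (p * L) <= s' by move: s'1; rewrite (_ : 2 * L * p = 2 * (p * L)) //; ring.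
have s2' : s <= p * L by rewrite mulrC.
have ks' : k * s' <= 2 * (p * (k * L ^+ 2)).
  apply: (@le_trans _ _ (k * (L * (2 * L * p)))); first by rewrite ler_wpM2l.
  by rewrite le_eqVlt; apply/orP; left; apply/eqP; ring.
have := @cantor_function_nondecreasing R x a.
have := @cantor_function_nondecreasing R (a + p) (x + s').
have pL2 : 0 <= p * L ^+ 2 by lra.
lra.
Qed.

(** Off the graph, which is closed, the start of any ray is free. *)
Lemma free_ray (R : realType) (x y a b L d : R) :
  0 < a -> 0 < b -> 1 <= L -> 0 < d ->
  exists t, [/\ 0 < t, L * t < d & forall s, t <= s <= L * t ->
    ~ graph_point (x + s * a) (y + s * b)].
Proof.
move=> a0 b0 L1 d0; have L0 : 0 < L by lra.
have [[Cx ->]|/graph_open [r r0 Hr]] := pselect (graph_point x y).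
  have [t [t0 td Ht]] := free_ray_from_graph Cx
    (ltac:(by rewrite ltW // divr_gt0) : 0 <= b / a) L1 (mulr_gt0 d0 a0).
  exists (t / a); split; first by rewrite divr_gt0.
    by rewrite mulrA ltr_pdivrMr.
  move=> s; rewrite ler_pdivrMr // mulrA ler_pdivlMr // => /Ht.
  by rewrite (_ : b / a * (s * a) = s * b) // mulrCA mulrAC mulfK // gt_eqF.
pose m := Num.min d (r / (a + b)).
have ab0 : 0 < a + b by lra.
have m0 : 0 < m by rewrite lt_min d0 divr_gt0.
exists (m / (2 * L)); have ML : L * (m / (2 * L)) = m / 2.
  by field; rewrite gt_eqF.
split; first by rewrite divr_gt0 // mulr_gt0.
  by rewrite ML; apply: (@lt_le_trans _ _ m); [lra|rewrite ge_min lexx].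
rewrite ML => s /andP[s1 s2]; have s0 : 0 < s.
  by apply: lt_le_trans s1; rewrite divr_gt0 // mulr_gt0.
have sab : s * (a + b) < r.
  rewrite -ltr_pdivlMr //; apply: (@lt_le_trans _ _ m); first lra.
  by rewrite ge_min lexx orbT.
have sa0 := mulr_gt0 s0 a0; have sb0 := mulr_gt0 s0 b0.
apply: Hr; rewrite addrAC subrr add0r ger0_norm; lra.
Qed.

(** * Semicontinuity and convexity along segments *)

(** The continuous summand [G] is kept apart because semicontinuity of [F] is
    what has to be checked in the applications. *)
Lemma compact_usc_max (R : realType) (T : topologicalType) (A : set T)
    (F G : T -> R) : A !=set0 -> compact A ->
  (forall p, A p -> forall e, 0 < e -> \forall q \near p, A q -> F q < F p + e) ->
  continuous G ->
  exists2 p, A p & forall q, A q -> F q + G q <= F p + G p.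
Proof.
move=> [a0 Aa0] cA uscF contG; pose H q := F q + G q; apply: contrapT => nomax.
have higher p : A p -> exists2 q, A q & H p < H q.
  move=> Ap; apply: contrapT => nq; apply: nomax; exists p => // q Aq.
  by rewrite leNgt; apply/negP => pq; apply: nq; exists q.
(* superlevel sets: their cluster point would be a maximum *)
pose B p := A `&` [set q | H p < H q].
have filB : Filter (filter_from A B).
  apply: filter_from_filter; first by exists a0.
  move=> p q Ap Aq; have [pq|qp] := leP (H p) (H q).
    by exists q => // z [Az /= qz]; do 2!split=> //=; apply: le_lt_trans qz.
  by exists p => // z [Az /= pz]; do 2!split=> //=; apply: lt_trans pz.
have propB : ProperFilter (filter_from A B).
  by apply: filter_from_proper => p /higher[q Aq pq]; exists q.
have [|p [Ap clp]] := cA _ propB; first by exists a0 => // q [].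
have [q Aq pq] := higher _ Ap.
pose e := (H q - H p) / 2; have e0 : 0 < e by rewrite divr_gt0 // subr_gt0.
have BFq : filter_from A B (B q) by exists q.
have nearp : nbhs p (fun z => A z -> H z < H q).
  have := uscF _ Ap _ e0; have /cvgrPdist_lt/(_ _ e0) := contG p.
  apply: filterS2 => z; rewrite ltr_norml => Gz Fz Az; have := Fz Az.
  by move: Gz; rewrite /H /e /H; lra.
by have [z [[Az /= qz] /(_ Az) zq]] := clp _ _ BFq nearp; lra.
Qed.

(** Adding a small strictly convex term to the defect of convexity produces an
    interior maximum at which the midpoint inequality fails. *)
Lemma local_midpoint_convex (R : realType) (p : R -> R) :
  (forall t, 0 <= t <= 1 -> forall e, 0 < e -> exists2 r, 0 < r &
     forall t', 0 <= t' <= 1 -> `|t' - t| < r -> p t' < p t + e) ->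
  (forall t, 0 < t < 1 -> exists r, [/\ 0 < r, 0 <= t - r, t + r <= 1
     & 2 * p t <= p (t - r) + p (t + r)]) ->
  forall t, 0 <= t <= 1 -> p t <= (1 - t) * p 0 + t * p 1.
Proof.
move=> usc mid t0 t001; rewrite leNgt; apply/negP => above.
pose m := p t0 - ((1 - t0) * p 0 + t0 * p 1).
have m0 : 0 < m by rewrite subr_gt0.
pose G (t : R) := t * (p 0 - p 1) + m / 2 * (t * t) - p 0.
have [|||s /= + smax] := @compact_usc_max R R `[0, 1] p G _ (@segment_compact _ 0 1).
- by exists 0; rewrite /= in_itv /=; lra.
- move=> t /=; rewrite in_itv /= => t01 e e0; have [r r0 Hr] := usc t t01 e e0.
  apply/nbhs_ballP; exists r => // t'; rewrite -ball_normE /= distrC.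
  by rewrite in_itv /= => d t'01; apply: Hr.
- move=> t; rewrite /G; apply: cvgB; last exact: cvg_cst.
  apply: cvgD; first by apply: cvgM; [exact: cvg_id|exact: cvg_cst].
  by apply: cvgM; [exact: cvg_cst|apply: cvgM; exact: cvg_id].
rewrite in_itv /= => s01.
have {}smax t : 0 <= t <= 1 -> p t + G t <= p s + G s.
  by move=> t01; apply: smax; rewrite /= in_itv.
have mt0 : m <= p t0 + G t0.
  have : 0 <= m / 2 * (t0 * t0) by rewrite mulr_ge0 ?mulr_ge0 //; lra.
  by rewrite /G /m; lra.
have G0 : G 0 = - p 0 by rewrite /G; ring.
have G1 : G 1 = - p 1 + m / 2 by rewrite /G; ring.
have := smax _ t001.
have [s0|s0] := eqVneq s 0; first by rewrite s0 G0; lra.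
have [s1|s1] := eqVneq s 1; first by rewrite s1 G1; lra.
have [|r [r0 sr1 sr2 mids]] := mid s.
  by rewrite !lt_neqAle s1 eq_sym s0.
have := smax (s - r); have := smax (s + r).
have : 0 < m / 2 * (r * r) by rewrite !mulr_gt0 //; lra.
have : G (s - r) + G (s + r) = 2 * G s + 2 * (m / 2 * (r * r)).
  by rewrite /G; ring.
lra.
Qed.

Definition box (R : realType) (x y r x' y' : R) :=
  `|x' - x| < r /\ `|y' - y| < r.

Lemma box_center (R : realType) (x y r : R) : 0 < r -> box x y r x y.
Proof. by move=> r0; rewrite /box !subrr normr0. Qed.

Lemma box_le (R : realType) (x y r r' x' y' : R) :
  r <= r' -> box x y r x' y' -> box x y r' x' y'.
Proof. by move=> rr [? ?]; split; apply: lt_le_trans rr. Qed.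

Lemma box_open (R : realType) (x y r x' y' : R) : box x y r x' y' ->
  exists2 s, 0 < s & forall x'' y'', box x' y' s x'' y'' -> box x y r x'' y''.
Proof.
move=> [dx dy]; exists (Num.min (r - `|x' - x|) (r - `|y' - y|)).
  by rewrite lt_min !subr_gt0 dx.
move=> x'' y''; rewrite /box !lt_min => -[/andP[dx' _] /andP[_ dy']]; split.
  by have := ler_distD x' x'' x; lra.
by have := ler_distD y' y'' y; lra.
Qed.

Lemma box_convex (R : realType) (x y r x1 y1 x2 y2 t : R) :
  box x y r x1 y1 -> box x y r x2 y2 -> 0 <= t <= 1 ->
  box x y r ((1 - t) * x1 + t * x2) ((1 - t) * y1 + t * y2).
Proof.
move=> [+ +] [+ +] /andP[t0 t1].
suff conv (u u1 u2 : R) : `|u1 - u| < r -> `|u2 - u| < r ->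
    `|(1 - t) * u1 + t * u2 - u| < r by move=> *; split; exact: conv.
move=> d1 d2.
have -> : (1 - t) * u1 + t * u2 - u = (1 - t) * (u1 - u) + t * (u2 - u) by ring.
have := ler_normD ((1 - t) * (u1 - u)) (t * (u2 - u)).
rewrite !normrM (ger0_norm t0) (@ger0_norm _ (1 - t)); last lra.
move=> le; apply: (le_lt_trans le).
have [->|tn0] := eqVneq t 0; first lra.
have tp : 0 < t by rewrite lt_neqAle eq_sym tn0.
have : t * `|u2 - u| < t * r by rewrite ltr_pM2l.
have : (1 - t) * `|u1 - u| <= (1 - t) * r by apply: ler_wpM2l; lra.
lra.
Qed.

(** Planar sets and functions are given in coordinates, and boxes are the balls
    of the supremum norm, see [open_planar] and [ball_plane_point]. *)
Definition planar_open (R : realType) (W : R -> R -> Prop) :=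
  forall x y, W x y ->
  exists2 r, 0 < r & forall x' y', box x y r x' y' -> W x' y'.

Definition convex_on (R : realType) (V : R -> R -> Prop) (F : R -> R -> R) :=
  forall x1 y1 x2 y2 t, V x1 y1 -> V x2 y2 -> 0 <= t <= 1 ->
  F ((1 - t) * x1 + t * x2) ((1 - t) * y1 + t * y2)
    <= (1 - t) * F x1 y1 + t * F x2 y2.

Definition box_locally_convex (R : realType) (W : R -> R -> Prop)
    (F : R -> R -> R) :=
  forall x y, W x y -> exists r, [/\ 0 < r,
    forall x' y', box x y r x' y' -> W x' y' & convex_on (box x y r) F].

Definition usc_at (R : realType) (F : R -> R -> R) (x y : R) :=
  forall e, 0 < e -> exists2 r, 0 < r &
    forall x' y', box x y r x' y' -> F x' y' < F x y + e.

Lemma convex_combination_le (R : realType) (a b t M : R) :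
  0 <= t <= 1 -> a <= M -> b <= M -> (1 - t) * a + t * b <= M.
Proof.
move=> /andP[t0 t1] aM bM.
have : t * b <= t * M by rewrite ler_wpM2l.
have : (1 - t) * a <= (1 - t) * M by apply: ler_wpM2l; lra.
lra.
Qed.

(** Near a point, a convex function is bounded above by its values at the
    corners of a square; convexity between the centre and the boundary of the
    square turns this bound into continuity at the centre. *)
Lemma convex_continuous (R : realType) (F : R -> R -> R) (x y r : R) :
  0 < r -> convex_on (box x y r) F ->
  forall e, 0 < e -> exists2 s, 0 < s &
    forall x' y', box x y s x' y' -> `|F x' y' - F x y| < e.
Proof.
move=> r0 cF e e0; pose d := r / 2; have d0 : 0 < d by rewrite divr_gt0.
have inbox u w : `|u| <= d -> `|w| <= d -> box x y r (x + u) (y + w).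
  by rewrite /box addrAC subrr add0r (addrAC y) subrr add0r /d; lra.
have dd : `|d| <= d by rewrite gtr0_norm.
have dNd : `|- d| <= d by rewrite normrN.
have bary u : `|u| <= d ->
    exists t, 0 <= t <= 1 /\ (1 - t) * - d + t * d = u.
  rewrite ler_norml => /andP[u1 u2]; exists ((u + d) / (2 * d)).
  split; last by field; rewrite gt_eqF.
  by rewrite ler_pdivlMr ?ler_pdivrMr ?mulr_gt0 //; lra.
have [M hM] : exists M, forall u w, `|u| <= d -> `|w| <= d ->
    F (x + u) (y + w) <= M.
  pose M := Num.max (Num.max (F (x - d) (y - d)) (F (x + d) (y - d)))
                    (Num.max (F (x - d) (y + d)) (F (x + d) (y + d))).
  exists M => u w du dw.
  have hor w' : `|w'| <= d -> F (x - d) (y + w') <= M ->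
      F (x + d) (y + w') <= M -> F (x + u) (y + w') <= M.
    move=> dw' h1 h2; have [t [t01 uE]] := bary _ du.
    have := cF _ _ _ _ _ (inbox _ _ dNd dw') (inbox _ _ dd dw') t01.
    rewrite (_ : (1 - _) * _ + _ = x + u); last by rewrite -uE; ring.
    rewrite (_ : (1 - _) * _ + _ = y + w'); last by ring.
    by move=> le; apply: (le_trans le); apply: convex_combination_le.
  have [t [t01 wE]] := bary _ dw.
  have := cF _ _ _ _ _ (inbox _ _ du dNd) (inbox _ _ du dd) t01.
  rewrite (_ : (1 - _) * _ + _ = x + u); last by ring.
  rewrite (_ : (1 - _) * _ + _ = y + w); last by rewrite -wE; ring.
  move=> le; apply: (le_trans le); apply: convex_combination_le => //;
    apply: hor => //; rewrite /M !le_max lexx ?orbT //.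
pose D := `|M - F x y| + e; have D0 : 0 < D by rewrite ltr_wpDl.
pose s := e / (2 * D); have s0 : 0 < s by rewrite divr_gt0 ?mulr_gt0.
have sD : s * D = e / 2 by rewrite /s; field; rewrite gt_eqF.
have s1 : s <= 1.
  by rewrite /s ler_pdivrMr ?mulr_gt0 // /D; have := normr_ge0 (M - F x y); lra.
have sM : s * (M - F x y) < e.
  have : s * (M - F x y) <= s * D.
    by rewrite ler_pM2l // /D; have := ler_norm (M - F x y); lra.
  lra.
have usc u w : `|u| < s * d -> `|w| < s * d -> F (x + u) (y + w) < F x y + e.
  move=> du dw; have scale z : `|z| < s * d -> `|z / s| <= d.
    by move=> dz; rewrite normrM normfV (gtr0_norm s0) ler_pdivrMr // mulrC ltW.
  have := cF _ _ _ _ s (box_center x y r0) (inbox _ _ (scale _ du) (scale _ dw)).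
  rewrite (_ : (1 - _) * _ + _ = x + u); last by field; rewrite gt_eqF.
  rewrite (_ : (1 - _) * _ + _ = y + w); last by field; rewrite gt_eqF.
  move=> /(_ ltac:(lra)) le; apply: (le_lt_trans le).
  have := hM _ _ (scale _ du) (scale _ dw).
  by rewrite -(ler_pM2l s0); lra.
exists (s * d); first exact: mulr_gt0.
move=> x' y' [dx dy].
have -> : x' = x + (x' - x) by ring.
have -> : y' = y + (y' - y) by ring.
move: (x' - x) (y' - y) dx dy => u w du dw.
have above := usc _ _ du dw.
have below : F (x - u) (y - w) < F x y + e by apply: usc; rewrite normrN.
have sd : s * d <= d by rewrite -ler_pdivlMr // divff ?gt_eqF.
have := cF (x + u) (y + w) (x - u) (y - w) (1 / 2).
rewrite (_ : _ * (x + u) + _ = x); last by field.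
rewrite (_ : _ * (y + w) + _ = y); last by field.
have bu := inbox u w ltac:(lra) ltac:(lra).
have := inbox (- u) (- w); rewrite !normrN => /(_ ltac:(lra) ltac:(lra)) bNu.
by move=> /(_ bu bNu ltac:(lra)); rewrite ltr_norml; lra.
Qed.

Lemma box_locally_convex_continuous (R : realType) (W : R -> R -> Prop)
    (F : R -> R -> R) (x y e : R) : box_locally_convex W F -> W x y -> 0 < e ->
  exists2 s, 0 < s & forall x' y', box x y s x' y' -> `|F x' y' - F x y| < e.
Proof. by move=> lF /lF[r [r0 _ cF]] e0; exact: (convex_continuous r0 cF e0). Qed.

(** On a segment inside the domain local convexity gives the local midpoint
    inequality, and [local_midpoint_convex] makes it global. *)
Lemma locally_convex_along_segment (R : realType) (W : R -> R -> Prop)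
    (F : R -> R -> R) (x y a b : R) : box_locally_convex W F ->
  (forall t, 0 <= t <= 1 -> W (x + t * a) (y + t * b)) ->
  forall t, 0 <= t <= 1 ->
  F (x + t * a) (y + t * b) <= (1 - t) * F x y + t * F (x + a) (y + b).
Proof.
move=> lF segW t t01.
pose c := `|a| + `|b| + 1.
have c0 : 0 < c by have := normr_ge0 a; have := normr_ge0 b; rewrite /c; lra.
have shrink t1 t2 r : `|t2 - t1| < r / c ->
    box (x + t1 * a) (y + t1 * b) r (x + t2 * a) (y + t2 * b).
  rewrite ltr_pdivlMr // => d.
  have coord u z : `|z| <= c -> `|u + t2 * z - (u + t1 * z)| < r.
    move=> zc; rewrite (_ : _ - _ = (t2 - t1) * z); last by ring.
    by rewrite normrM; apply: le_lt_trans d; rewrite ler_wpM2l.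
  by split; apply: coord; have := normr_ge0 a; have := normr_ge0 b; rewrite /c; lra.
have := @local_midpoint_convex R (fun t => F (x + t * a) (y + t * b)) _ _ t t01.
rewrite !mul0r !addr0 !mul1r; apply.
- move=> t1 t101 e e0.
  have [r r0 Hr] := box_locally_convex_continuous lF (segW _ t101) e0.
  exists (r / c); first exact: divr_gt0.
  move=> t2 t201 /shrink /Hr; rewrite ltr_norml; lra.
- move=> t1 t101; have [|r [r0 _ cF]] := lF _ _ (segW t1 _); first lra.
  pose r1 := r / c / 2; have r10 : 0 < r1 by rewrite !divr_gt0.
  pose s := Num.min r1 (Num.min t1 (1 - t1)).
  have s0 : 0 < s by rewrite !lt_min r10 subr_gt0.
  have sle : s <= r1 /\ s <= t1 /\ s <= 1 - t1.
    by rewrite /s !ge_min !lexx !orbT.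
  have sr : s < r / c by rewrite /r1 in r10 sle; lra.
  exists s; split=> //; [lra|lra|].
  have := cF _ _ _ _ (1 / 2) (@shrink t1 (t1 - s) r _) (@shrink t1 (t1 + s) r _).
  rewrite (_ : _ * (x + _) + _ = x + t1 * a); last by field.
  rewrite (_ : _ * (y + _) + _ = y + t1 * b); last by field.
  rewrite (_ : t1 - s - t1 = - s); last by ring.
  rewrite (_ : t1 + s - t1 = s); last by ring.
  rewrite normrN (gtr0_norm s0).
  by move=> /(_ sr sr ltac:(lra)); lra.
Qed.

(** * The extension across the graph *)

Definition off_graph (R : realType) (U : R -> R -> Prop) (x y : R) :=
  U x y /\ ~ graph_point x y.

(** Decreasing segments can be moved off the graph by an arbitrarily small
    translation, which makes the function convex along them. *)
Lemma decreasing_segment_perturb (R : realType) (U : R -> R -> Prop)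
    (F : R -> R -> R) (X Y r x y a b e : R) :
  box_locally_convex (off_graph U) F ->
  (forall x' y', box X Y r x' y' -> U x' y') ->
  box X Y r x y -> box X Y r (x + a) (y - b) -> 0 < a -> 0 < b -> 0 < e ->
  exists dx dy, [/\ `|dx| < e, `|dy| < e &
    forall t, 0 <= t <= 1 ->
      off_graph U (x + dx + t * a) (y + dy - t * b) /\
      F (x + dx + t * a) (y + dy - t * b) <=
        (1 - t) * F (x + dx) (y + dy) + t * F (x + dx + a) (y + dy - b)].
Proof.
move=> lF BU Bp Bq a0 b0 e0.
have [r1 r10 Hr1] := box_open Bp; have [r2 r20 Hr2] := box_open Bq.
have [] := @decreasing_line_avoids R a b x y (Num.min e (Num.min r1 r2)) a0 b0.
  by rewrite !lt_min e0 r10.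
move=> dx [dy []]; rewrite !lt_min => /and3P[dxe dx1 dx2] /and3P[dye dy1 dy2] av.
exists dx, dy; split=> //.
have off t : 0 <= t <= 1 -> off_graph U (x + dx + t * a) (y + dy - t * b).
  move=> t01; split=> //; apply: BU.
  have -> : x + dx + t * a = (1 - t) * (x + dx) + t * (x + a + dx) by ring.
  have -> : y + dy - t * b = (1 - t) * (y + dy) + t * (y - b + dy) by ring.
  apply: box_convex => //; [apply: Hr1|apply: Hr2];
    by split; rewrite addrAC subrr add0r.
move=> t t01; split; first exact: off.
have := @locally_convex_along_segment R _ F (x + dx) (y + dy) a (- b) lF.
move=> /(_ _ t t01); rewrite mulrN; apply=> s s01.
by rewrite mulrN; exact: off.
Qed.

(** Both bounds come from comparing with values at points of an antidiagonal
    line, which meets the graph only once. *)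
Lemma bounded_near_graph (R : realType) (U : R -> R -> Prop)
    (F : R -> R -> R) (x y : R) : planar_open U ->
  box_locally_convex (off_graph U) F -> graph_point x y -> U x y ->
  (exists M r, 0 < r /\ forall x' y', box x y r x' y' -> off_graph U x' y' ->
     F x' y' <= M) /\
  (exists m, forall r, 0 < r -> exists x' y',
     [/\ box x y r x' y', off_graph U x' y' & m <= F x' y']).
Proof.
move=> oU lF Gxy Uxy; have [rho rho0 BU] := oU _ _ Uxy.
pose c := rho / 4; have c0 : 0 < c by rewrite divr_gt0.
have near s : s != 0 -> `|s| <= 2 * c -> exists2 r, 0 < r &
    forall x' y', box (x + s) (y - s) r x' y' ->
      `|F x' y' - F (x + s) (y - s)| < 1.
  move=> s0 sc; apply: (box_locally_convex_continuous lF) => //; split.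
    apply: BU; split; rewrite addrAC subrr add0r ?normrN; rewrite /c in sc c0; lra.
  exact: decreasing_line_meets_once.
have normc : `|c| = c by rewrite gtr0_norm.
have [||rA rA0 HA] := near (- c); [by rewrite oppr_eq0 gt_eqF|by rewrite normrN; lra|].
have [||rB rB0 HB] := near c; [by rewrite gt_eqF|lra|].
have [||rC rC0 HC] := near (2 * c); [by rewrite gt_eqF; lra|by rewrite gtr0_norm; lra|].
rewrite opprK in HA.
pose r := Num.min c (Num.min (rA / 2) (Num.min (rB / 2) (rC / 2))).
have r0 : 0 < r by rewrite !lt_min c0 !divr_gt0.
have [rc [rA2 [rB2 rC2]]] : r <= c /\ 2 * r <= rA /\ 2 * r <= rB /\ 2 * r <= rC.
  have : r <= r by []; rewrite {2}/r !le_min => /and4P[? ? ? ?].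
  by do ?split; lra.
split.
  (* upper bound: an antidiagonal segment with midpoint near the given point *)
  exists ((F (x - c) (y + c) + 1 + F (x + c) (y - c) + 1) / 2 + 1), r.
  split=> // x' y' [dx' dy'] /[dup] -[Ux'y' nG] off'.
  have [s s0 Hs] := box_locally_convex_continuous lF off' (@ltr01 R).
  have [|||||dx [dy [dxe dye /(_ (1 / 2) ltac:(lra)) [_]]]] :=
    @decreasing_segment_perturb R U F x y rho (x' - c) (y' + c) (2 * c) (2 * c)
      (Num.min r s) lF BU; rewrite /box ?ltr_norml ?lt_min ?r0 //;
    rewrite ?ltr_norml in dx' dy'; try (rewrite /c in rc c0 *; lra).
  rewrite !lt_min !ltr_norml in dxe dye.
  rewrite (_ : x' - c + dx + 1 / 2 * (2 * c) = x' + dx); last by field.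
  rewrite (_ : y' + c + dy - 1 / 2 * (2 * c) = y' + dy); last by field.
  rewrite (_ : x' - c + dx + 2 * c = x' + c + dx); last by ring.
  rewrite (_ : y' + c + dy - 2 * c = y' - c + dy); last by ring.
  have := Hs (x' + dx) (y' + dy).
  have := HA (x' - c + dx) (y' + c + dy); have := HB (x' + c + dx) (y' - c + dy).
  rewrite /box !ltr_norml.
  move=> /(_ ltac:(lra)) hB /(_ ltac:(lra)) hA /(_ ltac:(lra)) hs; lra.
(* lower bound: a segment whose endpoint is the unknown point; its midpoint and
   its other endpoint are near points where F is controlled *)
exists (2 * (F (x + c) (y - c) - 1) - (F (x + 2 * c) (y - 2 * c) + 1)) => d d0.
have [|||||dx [dy [dxe dye H]]] :=
  @decreasing_segment_perturb R U F x y rho x y (2 * c) (2 * c)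
    (Num.min r d) lF BU; rewrite /box ?subrr ?normr0 ?ltr_norml ?lt_min ?r0 //;
  try (rewrite /c in rc c0 *; lra).
rewrite !lt_min !ltr_norml in dxe dye.
exists (x + dx), (y + dy).
have [off _] := H 0 ltac:(lra); rewrite !mul0r addr0 subr0 in off.
split=> //; first by rewrite /box !ltr_norml; lra.
have [_] := H (1 / 2) ltac:(lra).
rewrite (_ : x + dx + 1 / 2 * (2 * c) = x + c + dx); last by field.
rewrite (_ : y + dy - 1 / 2 * (2 * c) = y - c + dy); last by field.
rewrite (_ : x + dx + 2 * c = x + 2 * c + dx); last by ring.
rewrite (_ : y + dy - 2 * c = y - 2 * c + dy); last by ring.
have := HB (x + c + dx) (y - c + dy).
have := HC (x + 2 * c + dx) (y - 2 * c + dy).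
rewrite /box !ltr_norml => /(_ ltac:(lra)) hC /(_ ltac:(lra)) hB; lra.
Qed.

(** The upper limit at [(x, y)] of [F] along the complement of the graph. *)
Definition graph_limsup (R : realType) (U : R -> R -> Prop)
    (F : R -> R -> R) (x y : R) : R :=
  inf [set c | exists r, 0 < r /\ forall x' y', box x y r x' y' ->
    off_graph U x' y' -> F x' y' <= c].

(** The values on the graph are the upper limits of the values off the graph,
    which makes the extension upper semicontinuous. *)
Definition usc_extension (R : realType) (U : R -> R -> Prop)
    (F : R -> R -> R) (x y : R) : R :=
  if pselect (graph_point x y) then graph_limsup U F x y else F x y.

Lemma usc_extension_off (R : realType) (U : R -> R -> Prop) (F : R -> R -> R)
  (x y : R) : ~ graph_point x y -> usc_extension U F x y = F x y.
Proof. by rewrite /usc_extension; case: pselect. Qed.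

Lemma usc_extension_upper (R : realType) (U : R -> R -> Prop)
    (F : R -> R -> R) (x y e : R) : planar_open U ->
  box_locally_convex (off_graph U) F -> U x y -> 0 < e ->
  exists2 r, 0 < r & forall x' y', box x y r x' y' -> off_graph U x' y' ->
    F x' y' < usc_extension U F x y + e.
Proof.
move=> oU lF Uxy e0; rewrite /usc_extension; case: pselect => [G|nG] /=; last first.
  have [r r0 Hr] := box_locally_convex_continuous lF (conj Uxy nG) e0.
  by exists r => // x' y' /Hr; rewrite ltr_norml; lra.
have [[M [r [r0 HM]]] [m Hm]] := bounded_near_graph oU lF G Uxy.
have [] := @inf_adherent R [set c | exists r, 0 < r /\ forall x' y',
    box x y r x' y' -> off_graph U x' y' -> F x' y' <= c] e e0.
  split; first by exists M, r.
  exists m => c [s [s0 Hs]]; have [x' [y' [B off mF]]] := Hm s s0.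
  exact: le_trans mF (Hs _ _ B off).
move=> c [s [s0 Hs]] cI; exists s => // x' y' B off.
exact: le_lt_trans (Hs _ _ B off) cI.
Qed.

Lemma usc_extension_approx (R : realType) (U : R -> R -> Prop)
    (F : R -> R -> R) (x y e r : R) : planar_open U ->
  box_locally_convex (off_graph U) F -> U x y -> 0 < e -> 0 < r ->
  exists x' y', [/\ box x y r x' y', off_graph U x' y'
    & usc_extension U F x y - e < F x' y'].
Proof.
move=> oU lF Uxy e0 r0; rewrite /usc_extension; case: pselect => [G|nG] /=; last first.
  by exists x, y; split; [exact: box_center|split|rewrite ltrBlDr ltrDl].
have [_ [m Hm]] := bounded_near_graph oU lF G Uxy.
apply: contrapT => no.
suff : graph_limsup U F x y <= graph_limsup U F x y - e by lra.
apply: ge_inf.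
  exists m => c [s [s0 Hs]]; have [x' [y' [B off mF]]] := Hm s s0.
  exact: le_trans mF (Hs _ _ B off).
exists r; split=> // x' y' B off; rewrite leNgt; apply/negP => lt.
by apply: no; exists x', y'.
Qed.

Lemma usc_extension_usc (R : realType) (U : R -> R -> Prop)
    (F : R -> R -> R) (x y : R) : planar_open U ->
  box_locally_convex (off_graph U) F -> U x y ->
  usc_at (usc_extension U F) x y.
Proof.
move=> oU lF Uxy e e0; have e20 : 0 < e / 2 by rewrite divr_gt0.
have [r r0 Hr] := usc_extension_upper oU lF Uxy e20.
have [s s0 Hs] := oU _ _ Uxy.
exists (Num.min r s); first by rewrite lt_min r0.
move=> x' y' B.
have Br : box x y r x' y' by apply: box_le B; rewrite ge_min lexx.
have Bs : box x y s x' y' by apply: box_le B; rewrite ge_min lexx orbT.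
have [d d0 Hd] := box_open Br.
have [x1 [y1 [/Hd B1 off1]]] := usc_extension_approx oU lF (Hs _ _ Bs) e20 d0.
by have := Hr _ _ B1 off1; lra.
Qed.

(** The value at the intermediate point is approximated by a value off the
    graph, and a translate of the segment that avoids the graph passes near that
    point; upper semicontinuity controls the endpoints. *)
Lemma usc_extension_decreasing_strict (R : realType) (U : R -> R -> Prop)
    (F : R -> R -> R) (X Y r x y a b t : R) : planar_open U ->
  box_locally_convex (off_graph U) F ->
  (forall x' y', box X Y r x' y' -> U x' y') ->
  box X Y r x y -> box X Y r (x + a) (y - b) -> 0 < a -> 0 < b -> 0 <= t <= 1 ->
  usc_extension U F (x + t * a) (y - t * b) <=
    (1 - t) * usc_extension U F x y + t * usc_extension U F (x + a) (y - b).
Proof.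
move=> oU lF BU Bp Bq a0 b0 t01; set G := usc_extension U F.
apply/ler_addgt0Pr => e' e'0; pose e := e' / 3.
have e0 : 0 < e by rewrite divr_gt0.
have [r1 r10 Hr1] := box_open Bp; have [r2 r20 Hr2] := box_open Bq.
have [r3 r30 Hr3] := usc_extension_upper oU lF (BU _ _ Bp) e0.
have [r4 r40 Hr4] := usc_extension_upper oU lF (BU _ _ Bq) e0.
pose d := Num.min (Num.min r1 r2) (Num.min r3 r4) / 2.
have d0 : 0 < d by rewrite divr_gt0 // !lt_min r10 r20 r30.
have [dr1 [dr2 [dr3 dr4]]] : 2 * d <= r1 /\ 2 * d <= r2 /\ 2 * d <= r3 /\ 2 * d <= r4.
  have : 2 * d <= Num.min (Num.min r1 r2) (Num.min r3 r4) by rewrite /d; lra.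
  by rewrite !le_min => /andP[/andP[? ?] /andP[? ?]].
have Uz : U (x + t * a) (y - t * b).
  apply: BU; rewrite (_ : x + t * a = (1 - t) * x + t * (x + a)); last by ring.
  by rewrite (_ : y - t * b = (1 - t) * y + t * (y - b)); [apply: box_convex|ring].
have [x1 [y1 [[dx1 dy1] off1 G1]]] := usc_extension_approx oU lF Uz e0 d0.
have [s s0 Hs] := box_locally_convex_continuous lF off1 e0.
rewrite !ltr_norml in dx1 dy1.
have start : box X Y r (x1 - t * a) (y1 + t * b).
  by apply: Hr1; rewrite /box !ltr_norml; lra.
have stop : box X Y r (x1 - t * a + a) (y1 + t * b - b).
  by apply: Hr2; rewrite /box !ltr_norml; lra.
have [|dx [dy []]] := @decreasing_segment_perturb R U F X Y r _ _ a b (Num.min d s)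
  lF BU start stop a0 b0; first by rewrite lt_min d0.
rewrite !lt_min !ltr_norml => dxd dyd H.
have [] := (H 0 ltac:(lra), (H 1 ltac:(lra), H t t01)).
rewrite !mul0r !mul1r !addr0 !subr0 => -[off0 _] [[offq _] [_]].
rewrite (_ : x1 - t * a + dx + t * a = x1 + dx); last by ring.
rewrite (_ : y1 + t * b + dy - t * b = y1 + dy); last by ring.
have := Hs (x1 + dx) (y1 + dy).
rewrite /box !ltr_norml => /(_ ltac:(lra)) Fz.
have := Hr3 _ _ _ off0; rewrite /box !ltr_norml => /(_ ltac:(lra)) Fp.
have := Hr4 _ _ _ offq; rewrite /box !ltr_norml => /(_ ltac:(lra)) Fq.
move=> conv.
have : (1 - t) * F (x1 - t * a + dx) (y1 + t * b + dy) <= (1 - t) * (G x y + e).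
  by apply: ler_wpM2l; [lra|exact: ltW].
have : t * F (x1 - t * a + dx + a) (y1 + t * b + dy - b)
    <= t * (G (x + a) (y - b) + e).
  by apply: ler_wpM2l; [lra|exact: ltW].
have e3 : e' = 3 * e by rewrite /e; field.
by move: G1; rewrite -/G; lra.
Qed.

(** Horizontal and vertical segments are limits of decreasing ones through the
    same intermediate point; upper semicontinuity at the endpoints suffices to
    pass to the limit. *)
Lemma usc_extension_decreasing (R : realType) (U : R -> R -> Prop)
    (F : R -> R -> R) (X Y r x y a b t : R) : planar_open U ->
  box_locally_convex (off_graph U) F ->
  (forall x' y', box X Y r x' y' -> U x' y') ->
  box X Y r x y -> box X Y r (x + a) (y - b) -> 0 <= a -> 0 <= b ->
  0 <= t <= 1 ->
  usc_extension U F (x + t * a) (y - t * b) <=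
    (1 - t) * usc_extension U F x y + t * usc_extension U F (x + a) (y - b).
Proof.
move=> oU lF BU Bp Bq a0 b0 t01; set G := usc_extension U F.
apply/ler_addgt0Pr => e e0.
have [r1 r10 Hr1] := box_open Bp; have [r2 r20 Hr2] := box_open Bq.
have [r3 r30 Hr3] := usc_extension_usc oU lF (BU _ _ Bp) e0.
have [r4 r40 Hr4] := usc_extension_usc oU lF (BU _ _ Bq) e0.
pose d := Num.min (Num.min r1 r2) (Num.min r3 r4) / 2.
have d0 : 0 < d by rewrite divr_gt0 // !lt_min r10 r20 r30.
have [dr1 [dr2 [dr3 dr4]]] : 2 * d <= r1 /\ 2 * d <= r2 /\ 2 * d <= r3 /\ 2 * d <= r4.
  have : 2 * d <= Num.min (Num.min r1 r2) (Num.min r3 r4) by rewrite /d; lra.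
  by rewrite !le_min => /andP[/andP[? ?] /andP[? ?]].
have td : 0 <= t * d <= d.
  by apply/andP; split; [rewrite mulr_ge0 //; lra|rewrite ler_piMl //; lra].
have start : forall q, 2 * d <= q -> box x y q (x - t * d) (y + t * d).
  by move=> q dq; rewrite /box !ltr_norml; lra.
have stop : forall q, 2 * d <= q ->
    box (x + a) (y - b) q (x - t * d + (a + d)) (y + t * d - (b + d)).
  by move=> q dq; rewrite /box !ltr_norml; lra.
have := @usc_extension_decreasing_strict R U F X Y r (x - t * d) (y + t * d)
  (a + d) (b + d) t oU lF BU (Hr1 _ _ (start _ dr1)) (Hr2 _ _ (stop _ dr2))
  ltac:(lra) ltac:(lra) t01.
rewrite (_ : x - t * d + t * (a + d) = x + t * a); last by ring.
rewrite (_ : y + t * d - t * (b + d) = y - t * b); last by ring.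
rewrite -/G => le; apply: (le_trans le).
have := Hr3 _ _ (start _ dr3); have := Hr4 _ _ (stop _ dr4); rewrite -/G => Gq Gp.
have : (1 - t) * G (x - t * d) (y + t * d) <= (1 - t) * (G x y + e).
  by apply: ler_wpM2l; [lra|exact: ltW].
have : t * G (x - t * d + (a + d)) (y + t * d - (b + d))
    <= t * (G (x + a) (y - b) + e).
  by apply: ler_wpM2l; [lra|exact: ltW].
lra.
Qed.

(** * Convexity of the extension *)

(** [u] measures a function in the frame made of an increasing direction and
    the vertical direction, after subtraction of an affine function. It is
    touched from above at the origin by a quadratic function that is concave in
    the increasing direction. Convexity on horizontal lines gives [0 <= u] on
    the horizontal axis; then convexity on vertical lines bounds [u] below by
    a multiple of [- s ^ 2] on the increasing ray. A function convex between [t]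
    and [L t], nonpositive at [t] and at most [- e (L t) ^ 2] at [L t], is at
    most of order [- e L t ^ 2] at [2 t]: for [L] large this is too low. *)
Lemma touching_contradiction (R : realType) (u : R -> R -> R) (M e b d : R) :
  0 < e -> 0 <= M -> 0 < b -> 0 < d ->
  (forall s z, `|s| < d -> `|z| < 2 * b * d ->
     u s z <= M * z ^+ 2 - e * s ^+ 2) ->
  (forall s s', 0 < s < d -> 0 < s' < d ->
     0 <= s' * u (- s) (b * s) + s * u s' (- (b * s'))) ->
  (forall s, 0 < s < d ->
     2 * u s (- (b * s)) <= u s 0 + u s (- (2 * b * s))) ->
  (forall L, 2 < L -> exists t, [/\ 0 < t, L * t < d &
     (L - 1) * u (2 * t) 0 <= (L - 2) * u t 0 + u (L * t) 0]) -> False.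
Proof.
move=> e0 M0 b0 d0 touch hor ver ray.
have bs s : 0 < s < d -> 0 < b * s /\ b * s < b * d.
  by move=> /andP[s0 sd]; rewrite mulr_gt0 // ltr_pM2l.
have bd := bs d.
pose K := M * b ^+ 2; have K0 : 0 <= K by rewrite mulr_ge0 // exprn_ge0 // ltW.
have axis s : 0 < s < d -> 0 <= u s (- (b * s)).
  move=> s0d; rewrite leNgt; apply/negP => neg.
  have sK : 0 <= s * K by rewrite mulr_ge0 //; lra.
  pose w := - u s (- (b * s)); have w0 : 0 < w by rewrite oppr_gt0.
  pose s' := Num.min (d / 2) (w / (s * K + 1)).
  have s'0 : 0 < s' by rewrite lt_min !divr_gt0 //; lra.
  have s'd : 0 < s' < d.
    have : s' <= d / 2 by rewrite ge_min lexx.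
    lra.
  have s'K : s' * (s * K + 1) <= w.
    by rewrite -ler_pdivlMr; [rewrite ge_min lexx orbT|lra].
  have [b1 b2] := bs _ s'd.
  have := touch (- s') (b * s').
  rewrite normrN gtr0_norm // gtr0_norm //.
  move=> /(_ ltac:(lra) ltac:(lra)).
  rewrite (_ : M * (b * s') ^+ 2 = K * s' ^+ 2); last by rewrite /K; ring.
  rewrite sqrrN => tu.
  have es : 0 < e * s' ^+ 2 by rewrite mulr_gt0 ?exprn_gt0.
  have := hor _ _ s'd s0d.
  have : s * u (- s') (b * s') <= s * (K * s' ^+ 2).
    by rewrite ler_pM2l; lra.
  have -> : u s (- (b * s)) = - w by rewrite opprK.
  have -> : s * (K * s' ^+ 2) = s' * (s' * (s * K + 1)) - s' * s' by ring.
  have : s' * (s' * (s * K + 1)) <= s' * w by rewrite ler_pM2l.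
  have : 0 < s' * s' by rewrite mulr_gt0.
  lra.
have low s : 0 < s < d -> - (4 * K) * s ^+ 2 <= u s 0.
  move=> s0d; have [b1 b2] := bs _ s0d.
  have := touch s (- (2 * b * s)).
  rewrite normrN gtr0_norm ?gtr0_norm; [|by rewrite -mulrA; lra|lra].
  move=> /(_ ltac:(lra) ltac:(rewrite -!mulrA; lra)).
  rewrite (_ : M * _ ^+ 2 = 4 * K * s ^+ 2); last by rewrite /K; ring.
  have : 0 <= e * s ^+ 2 by rewrite mulr_ge0 ?sqr_ge0 // ltW.
  by have := ver _ s0d; have := axis _ s0d; lra.
have up s : 0 < s < d -> u s 0 <= - e * s ^+ 2.
  move=> s0d; have := touch s 0; rewrite normr0 gtr0_norm; last lra.
  have [? ?] : 0 < b * d /\ b * s < b * d.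
    by split; [rewrite mulr_gt0|have [] := bs _ s0d].
  move=> /(_ ltac:(lra) ltac:(rewrite -mulrA; lra)).
  by rewrite expr0n mulr0; lra.
pose L := 16 * K / e + 3.
have L3 : 3 <= L by rewrite lerDr divr_ge0 ?mulr_ge0 // ltW.
have eL : e * (L - 3) = 16 * K by rewrite /L; field; rewrite gt_eqF.
have [|t [t0 Ltd conv]] := ray L; first lra.
have t3 : 3 * t <= L * t by rewrite ler_pM2r.
have l2 := low (2 * t) ltac:(lra); have u1 := up t ltac:(lra).
have uL := up (L * t) ltac:(lra).
have et : 0 < e * t ^+ 2 by rewrite mulr_gt0 // exprn_gt0.
have : (L - 1) * (- (4 * K) * (2 * t) ^+ 2) <= (L - 1) * u (2 * t) 0.
  by apply: ler_wpM2l => //; lra.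
have : (L - 2) * u t 0 <= 0 by rewrite pmulr_rle0; lra.
rewrite (_ : (L - 1) * (- (4 * K) * (2 * t) ^+ 2) =
  - (L - 1) * (16 * K) * t ^+ 2); last by ring.
rewrite -eL (_ : - (L - 1) * (e * (L - 3)) * t ^+ 2 =
  - e * (L * t) ^+ 2 + e * t ^+ 2 + 4 * ((L - 1) * (e * t ^+ 2))); last by ring.
have : 0 < (L - 1) * (e * t ^+ 2) by rewrite mulr_gt0 //; lra.
lra.
Qed.

(** If convexity fails along an increasing segment, then the defect of
    convexity, corrected by a quadratic term [- M z ^ 2 + e s ^ 2] in the frame
    of the segment and the vertical, has a maximum on a thin parallelogram
    around the segment, and the choice of [M] and [e] makes it interior. *)
Lemma nonconvex_touching (R : realType) (G : R -> R -> R)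
    (X Y r x y a b t0 : R) : 0 < a -> 0 < b -> 0 <= t0 <= 1 ->
  (forall x' y', box X Y r x' y' -> usc_at G x' y') ->
  box X Y r x y -> box X Y r (x + a) (y + b) ->
  (1 - t0) * G x y + t0 * G (x + a) (y + b) < G (x + t0 * a) (y + t0 * b) ->
  exists p q k c M e d, [/\ 0 < e, 0 <= M, 0 < d &
    forall s z, `|s| < d -> `|z| < 2 * b * d ->
      box X Y r (p + s * a) (q + s * b + z) /\
      G (p + s * a) (q + s * b + z) - G p q - k * s - c * z
        <= M * z ^+ 2 - e * s ^+ 2].
Proof.
move=> a0 b0 t001 uscG Bp Bq above.
pose aff t := (1 - t) * G x y + t * G (x + a) (y + b).
pose m := G (x + t0 * a) (y + t0 * b) - aff t0.
have m0 : 0 < m by rewrite subr_gt0.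
have [r1 r10 Hr1] := box_open Bp; have [r2 r20 Hr2] := box_open Bq.
have [r3 r30 Hr3] := uscG _ _ Bp (m / 2) ltac:(by rewrite divr_gt0).
have [r4 r40 Hr4] := uscG _ _ Bq (m / 2) ltac:(by rewrite divr_gt0).
pose rho := Num.min (Num.min r1 r2) (Num.min r3 r4) / 2.
have rho0 : 0 < rho by rewrite divr_gt0 // !lt_min r10 r20 r30.
have [dr1 [dr2 [dr3 dr4]]] : rho < r1 /\ rho < r2 /\ rho < r3 /\ rho < r4.
  have : rho < Num.min (Num.min r1 r2) (Num.min r3 r4).
    by rewrite /rho in rho0 *; lra.
  by rewrite !lt_min => /andP[/andP[? ?] /andP[? ?]].
have vert x' y' z q : `|z| <= rho -> rho < q -> box x' y' q x' (y' + z).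
  move=> zr rq; rewrite /box subrr normr0 addrAC subrr add0r.
  by split; [lra|exact: le_lt_trans rq].
have par s z : 0 <= s <= 1 -> `|z| <= rho ->
    box X Y r (x + s * a) (y + s * b + z).
  move=> s01 zr.
  have -> : x + s * a = (1 - s) * x + s * (x + a) by ring.
  have -> : y + s * b + z = (1 - s) * (y + z) + s * (y + b + z) by ring.
  by apply: box_convex => //; [apply/Hr1/vert|apply/Hr2/vert].
pose A : set (R * R) := `[0, 1] `*` `[- rho, rho].
have inA s z : A (s, z) <-> 0 <= s <= 1 /\ `|z| <= rho.
  by rewrite /A /setX /= !in_itv /= ler_norml.
have A0 : A !=set0 by exists (0, 0); apply/inA; rewrite normr0; split; lra.
have cA : compact A by apply: compact_setX; exact: segment_compact.
pose H (p : R * R) := G (x + p.1 * a) (y + p.1 * b + p.2).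
have uscH p : A p -> forall e, 0 < e -> \forall q \near p, A q -> H q < H p + e.
  case: p => s z /inA[s01 zr] e e0.
  have [q q0 Hq] := uscG _ _ (par _ _ s01 zr) _ e0.
  pose c := a + b + 1; have c0 : 0 < c by rewrite /c; lra.
  apply/nbhs_ballP; exists (q / (2 * c)) => /=; first by rewrite divr_gt0 ?mulr_gt0.
  move=> [s' z'] [/= ds dz] _; apply: Hq.
  rewrite -!ball_normE /= !(distrC s, distrC z) !ltr_pdivlMr ?mulr_gt0 // in ds dz.
  have le w k : 0 <= k -> k <= c -> `|w| * (2 * c) < q -> `|w * k| < q / 2.
    move=> k0 kc wq; rewrite normrM (ger0_norm k0).
    have : `|w| * k <= `|w| * c by rewrite ler_wpM2l.
    lra.
  have sa := le (s' - s) a ltac:(lra) ltac:(rewrite /c; lra) ds.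
  have sb := le (s' - s) b ltac:(lra) ltac:(rewrite /c; lra) ds.
  have z1 := le (z' - z) 1 ltac:(lra) ltac:(rewrite /c; lra) dz.
  split=> /=.
    rewrite (_ : _ - _ = (s' - s) * a); [lra|ring].
  rewrite (_ : _ - _ = (s' - s) * b + (z' - z) * 1); last by ring.
  by have := ler_normD ((s' - s) * b) ((z' - z) * 1); lra.
have cfst : continuous (fun p : R * R => p.1) by move=> p; exact: cvg_fst.
have csnd : continuous (fun p : R * R => p.2) by move=> p; exact: cvg_snd.
have caff : continuous (fun p : R * R => aff p.1).
  move=> p; apply: cvgD; (apply: cvgM; last exact: cvg_cst).
    by apply: cvgB; [exact: cvg_cst|exact: cfst].
  exact: cfst.
have [] := @compact_usc_max R _ A H (fun p => - aff p.1) A0 cA uscH.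
  by move=> p; apply: cvgN; exact: caff.
move=> p1 _ bound; pose B := Num.max 0 (H p1 - aff p1.1).
(* M outweighs the largest defect on the long sides of the parallelogram *)
pose M := B / rho ^+ 2; pose e := m / 4.
have rho2 : 0 < rho ^+ 2 by rewrite exprn_gt0.
have M0 : 0 <= M by apply: divr_ge0; [rewrite le_max lexx|exact: ltW].
have e0 : 0 < e by rewrite divr_gt0.
have Mrho : M * rho ^+ 2 = B by rewrite /M divfK // gt_eqF.
pose Q (p : R * R) := e * (p.1 * p.1) - M * (p.2 * p.2) - aff p.1.
have [] := @compact_usc_max R _ A H Q A0 cA uscH.
  move=> p; apply: cvgB; last exact: caff.
  by apply: cvgB; (apply: cvgM; [exact: cvg_cst|apply: cvgM]);
    [exact: cfst|exact: cfst|exact: csnd|exact: csnd].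
move=> [s z] /inA[s01 zr] top.
have {}top s' z' : 0 <= s' <= 1 -> `|z'| <= rho ->
    H (s', z') + Q (s', z') <= H (s, z) + Q (s, z).
  by move=> ? ?; apply: top; apply/inA.
have topm : m <= H (s, z) + Q (s, z).
  apply: le_trans (top t0 0 t001 ltac:(by rewrite normr0; exact: ltW)).
  rewrite /H /Q /= addr0 !mulr0 subr0 /m.
  have et : 0 <= e * (t0 * t0) by rewrite mulr_ge0 ?mulr_ge0 //; lra.
  lra.
have Mz : 0 <= M * (z * z) by rewrite mulr_ge0 // -expr2 sqr_ge0.
(* the maximum is not on the short sides, where semicontinuity at the endpoints
   bounds the defect by m / 2, nor on the long sides, where M dominates *)
have s_gt0 : 0 < s.
  rewrite lt_neqAle; case/andP: s01 => -> _; rewrite andbT eq_sym.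
  apply/eqP => sE; have := Hr3 _ _ (vert x y z r3 zr dr3).
  by move: topm; rewrite sE /H /Q /aff /= !mul0r !addr0 mulr0; lra.
have s_lt1 : s < 1.
  rewrite lt_neqAle; case/andP: s01 => _ ->; rewrite andbT.
  apply/eqP => sE; have := Hr4 _ _ (vert (x + a) (y + b) z r4 zr dr4).
  by move: topm; rewrite sE /H /Q /aff /= !mul1r /e; lra.
have z_lt : `|z| < rho.
  rewrite lt_neqAle zr andbT; apply/eqP => zE.
  have Bm : H (s, z) - aff s <= B.
    by apply: (le_trans (bound (s, z) _)); [apply/inA|rewrite le_max lexx orbT].
  have zz : z * z = rho ^+ 2 by rewrite -zE real_normK ?num_real.
  have es : e * (s * s) <= e by rewrite ler_piMr ?mulr_ile1 //; clear -s01 e0; lra.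
  by move: topm; rewrite /Q /= zz Mrho; rewrite /e in es *; clear -es Bm m0; lra.
(* half of the room that the parallelogram leaves around the maximum *)
pose d := Num.min (Num.min s (1 - s)) ((rho - `|z|) / (2 * b)) / 2.
have d0 : 0 < d.
  by rewrite divr_gt0 // !lt_min s_gt0 subr_gt0 s_lt1 divr_gt0 ?subr_gt0 ?mulr_gt0.
have [ds [ds1 dz]] : d < s /\ d < 1 - s /\ 2 * b * d < rho - `|z|.
  have : d < Num.min (Num.min s (1 - s)) ((rho - `|z|) / (2 * b)).
    by rewrite /d in d0 *; lra.
  rewrite !lt_min => /andP[/andP[? ?]]; rewrite ltr_pdivlMr ?mulr_gt0 //.
  by rewrite mulrC.
have inpar s' z' : `|s'| < d -> `|z'| < 2 * b * d ->
    0 <= s + s' <= 1 /\ `|z + z'| <= rho.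
  rewrite ltr_norml => s'd z'd; split; first by clear -s'd ds ds1; lra.
  by have := ler_normD z z'; clear -dz z'd; lra.
exists (x + s * a), (y + s * b + z), (G (x + a) (y + b) - G x y - 2 * e * s),
  (2 * M * z), M, e, d; split=> // s' z' s'd z'd.
have [s'01 z'r] := inpar _ _ s'd z'd.
rewrite (_ : x + s * a + s' * a = x + (s + s') * a); last by ring.
rewrite (_ : y + s * b + z + s' * b + z' = y + (s + s') * b + (z + z')); last by ring.
split; first exact: par.
have := top _ _ s'01 z'r; clear; rewrite /H /Q /aff /=; lra.
Qed.

(** The extension is convex on horizontal and vertical segments, and by
    [free_ray] there are arbitrarily long stretches of increasing rays along
    which it is the given locally convex function. *)
Lemma usc_extension_increasing (R : realType) (U : R -> R -> Prop)
    (F : R -> R -> R) (X Y r x y a b t : R) : planar_open U ->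
  box_locally_convex (off_graph U) F ->
  (forall x' y', box X Y r x' y' -> U x' y') ->
  box X Y r x y -> box X Y r (x + a) (y + b) -> 0 < a -> 0 < b ->
  0 <= t <= 1 ->
  usc_extension U F (x + t * a) (y + t * b) <=
    (1 - t) * usc_extension U F x y + t * usc_extension U F (x + a) (y + b).
Proof.
move=> oU lF BU Bp Bq a0 b0 t01; set G := usc_extension U F.
rewrite leNgt; apply/negP => above.
have uscG x' y' : box X Y r x' y' -> usc_at G x' y'.
  by move=> /BU Ux'; exact: usc_extension_usc.
have [p [q [k [c [M [e [d [e0 M0 d0 touch]]]]]]]] :=
  nonconvex_touching a0 b0 t01 uscG Bp Bq above.
clear x y t Bp Bq t01 above uscG.
have hv := @usc_extension_decreasing R U F X Y r _ _ _ _ _ oU lF BU.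
have bs s : 0 < s < d -> 0 < b * s /\ b * s < b * d.
  by move=> /andP[s0 sd]; rewrite mulr_gt0 // ltr_pM2l.
have bd0 : 0 < b * d by rewrite mulr_gt0.
have inbox s z : `|s| < d -> `|z| < 2 * b * d -> box X Y r (p + s * a) (q + s * b + z).
  by move=> sd zd; have [] := touch s z sd zd.
apply: (@touching_contradiction R
  (fun s z => G (p + s * a) (q + s * b + z) - G p q - k * s - c * z) M e b d) => //.
- by move=> s z sd zd; have [] := touch s z sd zd.
- move=> s s' sd s'd; have [? ?] := bs _ sd; have [? ?] := bs _ s'd.
  have bL : box X Y r (p + - s * a) q.
    have := inbox (- s) (b * s).
    rewrite (_ : q + - s * b + b * s = q); last by ring.
    by apply; rewrite ?normrN gtr0_norm -?mulrA; lra.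
  have bR : box X Y r (p + - s * a + (s + s') * a) (q - 0).
    have := inbox s' (- (b * s')).
    rewrite (_ : q + s' * b - b * s' = q - 0); last by ring.
    rewrite (_ : p + s' * a = p + - s * a + (s + s') * a); last by ring.
    by apply; rewrite ?normrN gtr0_norm -?mulrA; lra.
  have ss0 : 0 < s + s' by lra.
  have ssa : 0 <= (s + s') * a by rewrite mulr_ge0 // ltW.
  have w01 : 0 <= s / (s + s') <= 1 by rewrite ler_pdivlMr // ler_pdivrMr //; lra.
  have := hv _ _ _ _ _ bL bR ssa (lexx _) w01; rewrite -/G -(ler_pM2l ss0).
  rewrite (_ : p + - s * a + s / (s + s') * ((s + s') * a) = p);
    last by field; rewrite gt_eqF.
  rewrite (_ : p + - s * a + (s + s') * a = p + s' * a); last by ring.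
  rewrite (_ : q + - s * b + b * s = q); last by ring.
  rewrite (_ : q + s' * b - b * s' = q); last by ring.
  rewrite mulr0 !subr0.
  move: (G p q) (G (p + - s * a) q) (G (p + s' * a) q) => g gl gr.
  rewrite (_ : (s + s') * ((1 - s / (s + s')) * gl + s / (s + s') * gr)
    = s' * gl + s * gr); last by field; rewrite gt_eqF.
  clear; lra.
- move=> s sd; have [? ?] := bs _ sd.
  have bT : box X Y r (p + s * a) (q + s * b).
    by have := inbox s 0; rewrite addr0 normr0 gtr0_norm; [apply; rewrite -?mulrA|]; lra.
  have bB : box X Y r (p + s * a + 0) (q + s * b - 2 * b * s).
    have := inbox s (- (2 * b * s)); rewrite addr0.
    by apply; rewrite ?normrN gtr0_norm -?mulrA; lra.
  have := hv _ _ _ _ (1 / 2) bT bB (lexx _) ltac:(rewrite -mulrA; lra) ltac:(lra).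
  rewrite -/G !mulr0 !addr0 (_ : q + s * b - 1 / 2 * (2 * b * s) = q + s * b - b * s);
    last by field.
  clear; lra.
move=> L L2.
(* convexity on the stretch from t to L * t of the ray, with intermediate point
   2 * t *)
have [t [tt0 Ltd free]] := free_ray p q a0 b0 (ltac:(lra) : 1 <= L) d0.
exists t; split=> //.
have tL : t < L * t by rewrite ltr_pMl //; lra.
have off w : 0 <= w <= 1 ->
    off_graph U (p + t * a + w * ((L - 1) * t * a)) (q + t * b + w * ((L - 1) * t * b)).
  move=> w01; pose v := t + w * (L * t - t).
  have tv : t <= v <= L * t.
    have : 0 <= w * (L * t - t) by rewrite mulr_ge0 //; lra.
    have : w * (L * t - t) <= L * t - t by rewrite ler_piMl //; lra.
    by rewrite /v; lra.
  rewrite (_ : p + _ + _ = p + v * a); last by rewrite /v; ring.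
  rewrite (_ : q + _ + _ = q + v * b); last by rewrite /v; ring.
  split; last exact: free.
  apply: BU; have := inbox v 0; rewrite addr0 normr0 gtr0_norm; last lra.
  by apply; rewrite -?mulrA; lra.
have L1 : 0 < L - 1 by lra.
have w01 : 0 <= (L - 1)^-1 <= 1 by rewrite invr_ge0 invf_le1 //; lra.
have le := locally_convex_along_segment lF off w01.
have GF w : 0 <= w <= 1 -> G (p + t * a + w * ((L - 1) * t * a)) (q + t * b + w * ((L - 1) * t * b))
    = F (p + t * a + w * ((L - 1) * t * a)) (q + t * b + w * ((L - 1) * t * b)).
  by move=> /off[_ nG]; exact: usc_extension_off.
have := GF 0 ltac:(lra); have := GF 1 ltac:(lra); have := GF _ w01.
rewrite !mul1r !mul0r !addr0.
rewrite (_ : p + t * a + (L - 1)^-1 * _ = p + 2 * t * a) in le *; last by field; rewrite gt_eqF.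
rewrite (_ : q + t * b + (L - 1)^-1 * _ = q + 2 * t * b) in le *; last by field; rewrite gt_eqF.
rewrite (_ : p + t * a + (L - 1) * t * a = p + L * t * a) in le *; last by ring.
rewrite (_ : q + t * b + (L - 1) * t * b = q + L * t * b) in le *; last by ring.
move=> G2 GL G1.
rewrite -G2 -GL -G1 -(ler_pM2l L1) in le.
move: le; clear -L1.
move: (G (p + 2 * t * a) _) (G (p + t * a) _) (G (p + L * t * a) _) => h2 h1 hL.
rewrite (_ : (L - 1) * ((1 - (L - 1)^-1) * h1 + (L - 1)^-1 * hL)
  = (L - 2) * h1 + hL); last by field; rewrite gt_eqF.
rewrite !mulr0 !subr0; lra.
Qed.

(** A segment is decreasing or increasing, up to exchanging its endpoints;
    horizontal and vertical segments count as decreasing. *)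
Lemma usc_extension_convex (R : realType) (U : R -> R -> Prop)
    (F : R -> R -> R) (X Y r : R) : planar_open U ->
  box_locally_convex (off_graph U) F ->
  (forall x' y', box X Y r x' y' -> U x' y') ->
  convex_on (box X Y r) (usc_extension U F).
Proof.
move=> oU lF BU.
have up x1 y1 x2 y2 t : x1 <= x2 -> (y1 < y2 -> x1 < x2) ->
    box X Y r x1 y1 -> box X Y r x2 y2 -> 0 <= t <= 1 ->
    usc_extension U F ((1 - t) * x1 + t * x2) ((1 - t) * y1 + t * y2) <=
      (1 - t) * usc_extension U F x1 y1 + t * usc_extension U F x2 y2.
  move=> x12 xy B1 B2 t01.
  have [y21|y12] := leP y2 y1.
    have := @usc_extension_decreasing R U F X Y r x1 y1 (x2 - x1) (y1 - y2) t oU lF BU.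
    rewrite (_ : x1 + (x2 - x1) = x2); last by ring.
    rewrite (_ : y1 - (y1 - y2) = y2); last by ring.
    rewrite (_ : x1 + t * (x2 - x1) = (1 - t) * x1 + t * x2); last by ring.
    rewrite (_ : y1 - t * (y1 - y2) = (1 - t) * y1 + t * y2); last by ring.
    by apply; rewrite // subr_ge0.
  have := @usc_extension_increasing R U F X Y r x1 y1 (x2 - x1) (y2 - y1) t oU lF BU.
  rewrite (_ : x1 + (x2 - x1) = x2); last by ring.
  rewrite (_ : y1 + (y2 - y1) = y2); last by ring.
  rewrite (_ : x1 + t * (x2 - x1) = (1 - t) * x1 + t * x2); last by ring.
  rewrite (_ : y1 + t * (y2 - y1) = (1 - t) * y1 + t * y2); last by ring.
  by apply; rewrite // subr_gt0 //; exact: xy.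
move=> x1 y1 x2 y2 t B1 B2 t01.
have [x12|x21|xE] := ltgtP x1 x2.
- by apply: up => //; exact: ltW.
- have := up x2 y2 x1 y1 (1 - t) (ltW x21) (fun=> x21) B2 B1 ltac:(lra).
  by rewrite opprB (addrC 1) addrNK (addrC (t * x2)) (addrC (t * y2)) (addrC (t * _)).
- have [y21|y12] := leP y2 y1.
    by apply: up => //; [rewrite xE|rewrite ltNge y21].
  have := up x2 y2 x1 y1 (1 - t) _ _ B2 B1 ltac:(lra).
  rewrite opprB (addrC 1) addrNK (addrC (t * x2)) (addrC (t * y2)) (addrC (t * usc_extension _ _ _ _)).
  by apply; [rewrite xE|rewrite ltNge ltW].
Qed.

Lemma usc_extension_locally_convex (R : realType) (U : R -> R -> Prop)
    (F : R -> R -> R) : planar_open U -> box_locally_convex (off_graph U) F ->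
  box_locally_convex U (usc_extension U F).
Proof.
move=> oU lF x y Uxy; have [r r0 BU] := oU _ _ Uxy; exists r; split=> //.
exact: usc_extension_convex.
Qed.

(** Both functions are determined by the values off the graph near the point:
    the first by continuity, the second as an upper limit. *)
Lemma locally_convex_extension_unique (R : realType) (U : R -> R -> Prop)
    (F H : R -> R -> R) (x y : R) : planar_open U ->
  box_locally_convex (off_graph U) F -> box_locally_convex U H ->
  (forall x' y', off_graph U x' y' -> H x' y' = F x' y') -> U x y ->
  H x y = usc_extension U F x y.
Proof.
move=> oU lF lH HF Uxy; apply/eqP; rewrite eq_le; apply/andP.
split; apply/ler_addgt0Pr => e e0; have e20 : 0 < e / 2 by rewrite divr_gt0.
  have [r r0 Hr] := usc_extension_upper oU lF Uxy e20.
  have [s s0 Hs] := box_locally_convex_continuous lH Uxy e20.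
  have rs0 : 0 < Num.min r s by rewrite lt_min r0.
  have [x' [y' [B off _]]] := usc_extension_approx oU lF Uxy e20 rs0.
  have := Hr x' y'; have := Hs x' y'; rewrite (HF _ _ off) ltr_norml.
  move=> /(_ (box_le _ B)) h1 /(_ (box_le _ B) off) h2.
  have := h1 ltac:(by rewrite ge_min lexx orbT).
  have := h2 ltac:(by rewrite ge_min lexx).
  lra.
have [s s0 Hs] := box_locally_convex_continuous lH Uxy e20.
have [x' [y' [B off]]] := usc_extension_approx oU lF Uxy e20 s0.
by have := Hs _ _ B; rewrite (HF _ _ off) ltr_norml; lra.
Qed.

(** * Coordinates of the plane *)

Lemma plane_point_coord (R : realType) (x y : R) :
  plane_point x y ord0 ord0 = x /\ plane_point x y ord0 ord_max = y.
Proof. by rewrite /plane_point !mxE. Qed.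

Lemma plane_pointK (R : realType) (v : 'rV[R]_2) :
  plane_point (v ord0 ord0) (v ord0 ord_max) = v.
Proof.
apply/rowP => i; rewrite mxE; case: ifPn => [/eqP-> //|i0].
by congr (v _ _); apply: val_inj; case: i i0 => -[|[|]].
Qed.

Lemma plane_point_conv (R : realType) (x1 y1 x2 y2 s t : R) :
  s *: plane_point x1 y1 + t *: plane_point x2 y2 =
  plane_point (s * x1 + t * x2) (s * y1 + t * y2).
Proof. by apply/rowP => i; rewrite !mxE; case: ifP. Qed.

Lemma ball_plane_point (R : realType) (x y r x' y' : R) : 0 < r ->
  ball (plane_point x y) r (plane_point x' y') <-> box x y r x' y'.
Proof.
move=> r0; split.
  move=> [_ B]; have := B ord0 ord0; have := B ord0 ord_max.
  by rewrite /plane_point !mxE /= -!ball_normE /= /box !(distrC x') !(distrC y').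
move=> [dx dy]; split=> // i j; rewrite /plane_point !mxE.
by case: ifP => _; rewrite -ball_normE /= distrC.
Qed.

Definition planar (R : realType) (W : set 'rV[R]_2) (x y : R) :=
  W (plane_point x y).

Lemma open_planar (R : realType) (W : set 'rV[R]_2) :
  open W <-> planar_open (planar W).
Proof.
split=> [oW x y Wxy|oW].
  have /nbhs_ballP[r /= r0 BW] := open_nbhs_nbhs (conj oW Wxy).
  by exists r => // x' y' B; apply/BW/ball_plane_point.
rewrite openE => v; rewrite -(plane_pointK v) => /oW[r r0 BW].
apply/nbhs_ballP; exists r => // w; rewrite -(plane_pointK w) => B.
by apply/BW/ball_plane_point.
Qed.

Lemma planar_cantor_graph (R : realType) (x y : R) :
  planar (cantor_graph R) x y <-> graph_point x y.
Proof.
split=> [[z Cz E]|[Cx ->]]; last by exists x.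
have [x1 y1] := plane_point_coord x y.
have [x2 y2] := plane_point_coord z (cantor_function z).
have <- : z = x by rewrite -x1 -E x2.
by have <- : cantor_function z = y by rewrite -y1 -E y2.
Qed.

Lemma conv_plane_point (R : realType) (k : {i01 R}) (x1 y1 x2 y2 : R) :
  conv k (plane_point x1 y1 : convex_lmodType 'rV[R]_2) (plane_point x2 y2) =
  plane_point (k%:num * x1 + (1 - k%:num) * x2) (k%:num * y1 + (1 - k%:num) * y2).
Proof. exact: plane_point_conv. Qed.

Lemma conv_regular (R : realType) (k : {i01 R}) (a b : R^o) :
  conv k a b = k%:num * a + (1 - k%:num) * b.
Proof. exact: convRE. Qed.

Lemma locally_convex_planar (R : realType) (W : set 'rV[R]_2)
    (f : 'rV[R]_2 -> R) :
  locally_convex_on W f <->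
  box_locally_convex (planar W) (fun x y => f (plane_point x y)).
Proof.
split=> [lf x y Wxy|lf v].
  have [V [oV _ Vxy VW cf]] := lf _ Wxy.
  have [r r0 BV] := (open_planar V).1 oV _ _ Vxy.
  exists r; split=> //; first by move=> x' y' /BV /VW.
  move=> x1 y1 x2 y2 t B1 B2 /andP[t0 t1].
  have t'0 : 0 <= 1 - t by rewrite subr_ge0.
  have t'1 : 1 - t <= 1 by rewrite gerBl.
  have := cf (Itv01 t'0 t'1) (plane_point x1 y1) (plane_point x2 y2).
  rewrite !inE => /(_ (BV _ _ B1) (BV _ _ B2)).
  by rewrite conv_plane_point conv_regular /= subKr.
rewrite -(plane_pointK v); move: (v ord0 ord0) (v ord0 ord_max) => {v} x y.
move=> /lf[r [r0 BW cf]]; exists (ball (plane_point x y) r).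
have k01 (k : {i01 R}) : 0 <= 1 - k%:num <= 1.
  by rewrite subr_ge0 gerBl le1 ge0.
split.
- exact: ball_open.
- move=> v w k; rewrite -(plane_pointK v) -(plane_pointK w) !inE.
  move=> /(ball_plane_point _ _ _ _ r0) B1 /(ball_plane_point _ _ _ _ r0) B2.
  rewrite conv_plane_point; apply/(ball_plane_point _ _ _ _ r0).
  by have := box_convex B1 B2 (k01 k); rewrite subKr.
- exact: ballxx.
- by move=> w; rewrite -(plane_pointK w) => /(ball_plane_point _ _ _ _ r0) /BW.
- move=> k v w; rewrite -(plane_pointK v) -(plane_pointK w) !inE.
  move=> /(ball_plane_point _ _ _ _ r0) B1 /(ball_plane_point _ _ _ _ r0) B2.
  rewrite conv_plane_point conv_regular.
  by have := cf _ _ _ _ _ B1 B2 (k01 k); rewrite subKr.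
Qed.

(** * The theorem *)

Lemma closed_cantor_graph (R : realType) : closed (cantor_graph R).
Proof.
rewrite -openC; apply/open_planar => x y nG.
have [|r r0 Hr] := @graph_open R x y; first by move=> /planar_cantor_graph.
by exists r => // x' y' [dx dy] /planar_cantor_graph; exact: Hr.
Qed.

Lemma eball_coord (R : realType) (d : nat) (x y : 'rV[R]_d) (e : R) i :
  eball x e y -> `|y ord0 i - x ord0 i| < e.
Proof.
apply: le_lt_trans; rewrite /enorm -sqrtr_sqr ler_wsqrtr // (bigD1 i) //= !mxE.
by rewrite lerDl sumr_ge0 // => j _; exact: sqr_ge0.
Qed.

(** Segments whose endpoints are close to [(-1, 1/4)] and [(2, 3/4)] lie on an
    increasing line, and cover the part of it over the unit interval. *)
Lemma cantor_graph_not_thin (R : realType) :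
  ~ intervally_thin (cantor_graph R).
Proof.
move=> thin.
have [] := thin (plane_point (-1) (1 / 4)) (plane_point 2 (3 / 4)) (1 / 16) _.
  by rewrite divr_gt0.
move=> v [w [Bv Bw]]; apply/eqP/set0P.
have := eball_coord ord0 Bv; have := eball_coord ord_max Bv.
have := eball_coord ord0 Bw; have := eball_coord ord_max Bw.
rewrite !mxE /= -(plane_pointK v) -(plane_pointK w).
move: (v ord0 ord0) (v ord0 ord_max) (w ord0 ord0) (w ord0 ord_max) => x1 y1 x2 y2.
clear; rewrite !mxE /= !ltr_norml => hy2 hx2 hy1 hx1.
have x120 : 0 < x2 - x1 by lra.
pose k := (y2 - y1) / (x2 - x1).
have k0 : 0 < k by rewrite divr_gt0 //; lra.
have kE : k * (x2 - x1) = y2 - y1 by rewrite /k divfK // gt_eqF.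
have k1 : k <= 1 / 4 by rewrite /k ler_pdivrMr //; lra.
have kx1 : 0 <= - (k * x1) <= 1 / 4 * - x1.
  rewrite -mulrN; apply/andP; split; first by rewrite mulr_ge0; lra.
  by rewrite ler_wpM2r //; lra.
have [||x Gx] := @increasing_line_meets R (y1 - k * x1) k k0; [lra|lra|].
have /andP[x0 x1'] := cantor01 Gx.1.
exists (plane_point x (y1 - k * x1 + k * x)); split; last exact/planar_cantor_graph.
exists ((x - x1) / (x2 - x1)).
  by rewrite /= in_itv /= ler_pdivlMr // ler_pdivrMr //; lra.
rewrite plane_point_conv; congr plane_point; first by field; rewrite gt_eqF.
have -> : y2 = y1 + k * (x2 - x1) by rewrite kE; ring.
by field; rewrite gt_eqF.
Qed.

Theorem mainTheorem5 (R : realType) :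
  [/\ closed (cantor_graph R),
      ~ intervally_thin (cantor_graph R)
    & forall U : set 'rV[R]_2, open U -> cantor_graph R `<=` U ->
      forall f : 'rV[R]_2 -> R, locally_convex_on (U `\` cantor_graph R) f ->
      exists g : 'rV[R]_2 -> R,
        locally_convex_extension U (cantor_graph R) f g /\
        (forall g' : 'rV[R]_2 -> R,
           locally_convex_extension U (cantor_graph R) f g' ->
           forall x, U x -> g' x = g x)].
Proof.
split; [exact: closed_cantor_graph|exact: cantor_graph_not_thin|].
move=> U /open_planar oU _ f /locally_convex_planar lf.
pose F x y := f (plane_point x y).
have offE x y : planar (U `\` cantor_graph R) x y <-> off_graph (planar U) x y.
  by split=> -[Uxy nG]; split=> // /planar_cantor_graph.
have lF : box_locally_convex (off_graph (planar U)) F.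
  move=> x y /offE /lf[r [r0 BW cF]]; exists r; split=> // x' y' B.
  by apply/offE; exact: BW.
pose G := usc_extension (planar U) F.
pose g (v : 'rV[R]_2) := G (v ord0 ord0) (v ord0 ord_max).
have gE x y : g (plane_point x y) = G x y.
  by have [xE yE] := plane_point_coord x y; rewrite /g xE yE.
exists g; split.
  split.
    apply/locally_convex_planar.
    rewrite (_ : (fun x y => _) = G); first exact: usc_extension_locally_convex.
    by apply/funext => x; apply/funext => y; exact: gE.
  move=> v [_ nK]; rewrite -(plane_pointK v) gE; apply: usc_extension_off.
  by move=> /planar_cantor_graph; rewrite /planar plane_pointK.
move=> g' [/locally_convex_planar lg' g'f] v Uv.
rewrite -(plane_pointK v) gE.
apply: (locally_convex_extension_unique (H := fun x y => g' (plane_point x y)) oU lF lg').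
  by move=> x y off; apply: g'f; apply/offE.
by rewrite /planar plane_pointK.
Qed.
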